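(* Let $V$ be an $n$-dimensional $k$-vector space, $(\mathbf F,\mathbf F')$ a pair of weakly opposite partial flags, $\mathfrak q=\mathfrak p_{\mathbf F}\cap\mathfrak p_{\mathbf F'}$ the associated seaweed Lie algebra, $\mathfrak n$ its nilpotent radical, $\mathbf Q=\mathbf P_{\mathbf F}\cap\mathbf P_{\mathbf F'}\subseteq\mathrm{GL}(V)$, and let $Q$, $\mathbf d=(\dim Y_s)_{1\le s\le l}$ be the quiver and dimension vector attached to $(\mathbf F,\mathbf F')$ as in the context. Then there is a bijection between the $\mathbf Q$-orbits in $\mathfrak n$ and the $\mathrm{GL}(\mathbf d)$-orbits in $\mathrm{Rep}_\Delta(\tilde Q,\mathcal I,\mathbf d)$. In particular, $\mathfrak n$ contains an open $\mathbf Q$-orbit if and only if $\mathrm{Rep}_\Delta(\tilde Q,\mathcal I,\mathbf d)$ contains an open $\mathrm{GL}(\mathbf d)$-orbit.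
   Context: $k$ is algebraically closed of characteristic zero. For $\mathbf a=(a_i)_{0\le i\le r}$ with $0=a_0<\dots<a_r=n$, a partial flag of type $\mathbf a$ is $0=V_0\subset V_1\subset\cdots\subset V_r=V$ with $\dim V_i=a_i$. For a flag $\mathbf F$, $\mathfrak p_{\mathbf F}\subseteq\mathfrak{gl}(V)$ and $\mathbf P_{\mathbf F}\subseteq\mathrm{GL}(V)$ denote its stabilizers. A pair $(\mathbf F,\mathbf F')$ of flags of types $\mathbf a=(a_i)_{0\le i\le r}$, $\mathbf b=(b_j)_{0\le j\le r'}$ is weakly opposite if there is a basis $e_1,\dots,e_n$ of $V$ with $V_i=\mathrm{Vect}(e_1,\dots,e_{a_i})$ and $V'_j=\mathrm{Vect}(e_{n-b_j+1},\dots,e_n)$ for $j>0$. Fix such a basis. Let $0=m_0<m_1<\dots<m_l=n$ be the elements of $\{a_i\}\cup\{n-b_j\}$, $E_s=\mathrm{Vect}(e_{m_{s-1}+1},\dots,e_{m_s})$ for $1\le s\le l$, $u(s)=\min\{i:E_s\subseteq V_i\}$, $\ell(s)=\min\{j:E_s\subseteq V'_j\}$, and $Y_s=V_{u(s)}\cap V'_{\ell(s)}$. For each $1\le s\le l-1$ exactly one of $Y_s\cap Y_{s+1}=0$, $Y_s\subsetneq Y_{s+1}$, $Y_{s+1}\subsetneq Y_s$ holds. $Q$ is the quiver with vertices $1,\dots,l$ and, for $1\le s\le l-1$, an arrow $\alpha_s:s\to s+1$ if $Y_s\subsetneq Y_{s+1}$, an arrow $\alpha_s:s+1\to s$ if $Y_{s+1}\subsetneq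 Y_s$, and no arrow otherwise (each connected component is of type $A$). The nilpotent radical $\mathfrak n$ of $\mathfrak q$ is the set of $x\in\mathfrak q$ whose diagonal blocks with respect to $V=E_1\oplus\dots\oplus E_l$ vanish. Double quiver $\tilde Q$ (arrows $\alpha$ and reversed $\alpha^*$), paths composed right to left, ideal $\mathcal I\subseteq k\tilde Q$ generated by $\alpha^*\alpha-\sum_{\gamma\in Q_1,t(\gamma)=s(\alpha)}\gamma\gamma^*$ ($\alpha\in Q_1$) and $\beta^*\alpha$ ($\alpha\neq\beta$, $t(\alpha)=t(\beta)$). $\mathrm{Rep}(\tilde Q,\mathcal I,\mathbf d)$ is the variety of representations of $(\tilde Q,\mathcal I)$ on the spaces $k^{d_i}$, with $\mathrm{GL}(\mathbf d)=\prod_i\mathrm{GL}_{d_i}(k)$ acting by conjugation; $\mathrm{Rep}_\Delta(\tilde Q,\mathcal I,\mathbf d)$ is the subset of representations $M$ such that every $M_\alpha$ ($\alpha\in Q_1$) is injective and $\mathrm{Im}(M_\alpha)\cap\sum_{\beta\in Q_1\setminus\{\alpha\},t(\beta)=t(\alpha)}\mathrm{Im}(M_\beta)=0$ (the $\Delta$-filtered modules). *)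

(* Defs.v *)
From HB Require Import structures.
From mathcomp Require Import all_boot all_order all_algebra.
Set Implicit Arguments. Unset Strict Implicit. Unset Printing Implicit Defensive.
Import GRing.Theory.
Local Open Scope ring_scope.

(* An affine space is modelled by a type X with coordinate functions          *)
(* coord : I -> X -> k identifying X with k^I.  Polynomial functions are the  *)
(* functions generated by constants and coordinates under + and *.           *)
Section Zariski.
Variables (k : fieldType) (X I : Type) (coord : I -> X -> k).

Inductive polyfun : (X -> k) -> Prop :=
| pf_const (c : k) : polyfun (fun _ => c)
| pf_coord (i : I) : polyfun (coord i)
| pf_add f g : polyfun f -> polyfun g -> polyfun (fun x => f x + g x)
| pf_mul f g : polyfun f -> polyfun g -> polyfun (fun x => f x * g x).

Definition zopen (W : X -> Prop) : Prop :=
  exists Fam : (X -> k) -> Prop,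
    (forall f, Fam f -> polyfun f) /\
    (forall x, W x <-> exists2 f, Fam f & f x != 0).

Definition zopen_in (S U : X -> Prop) : Prop :=
  (forall x, U x -> S x) /\
  exists2 W, zopen W & (forall x, S x -> (U x <-> W x)).

End Zariski.

(* Orbits of an action, given by the orbit relation R (R x y : y lies in the *)
(* orbit of x), on an invariant subset S.                                    *)
Section Orbits.
Variables (X : Type) (S : X -> Prop) (R : X -> X -> Prop).

Definition orbits := {O : X -> Prop | exists2 x, S x & O = R x}.

Definition has_open_orbit (I : Type) (k : fieldType) (coord : I -> X -> k) :=
  exists2 x, S x & zopen_in coord S (R x).

End Orbits.

(* Q has vertices 'I_l and arrows Ar with source qs and target qt.           *)
(* Arrows of the double quiver: (a, false) = a, (a, true) = a^*.             *)
(* Row-vector convention: a linear map k^p -> k^q is a matrix 'M_(p, q)      *)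
(* acting by v |-> v *m M, so the path "beta alpha" (alpha first) is         *)
(* M_alpha *m M_beta.                                                        *)
Section QuiverRep.
Variables (k : fieldType) (l : nat) (Ar : finType) (qs qt : Ar -> 'I_l)
          (d : 'I_l -> nat).

Definition dsrc (x : Ar * bool) : 'I_l := if x.2 then qt x.1 else qs x.1.
Definition dtgt (x : Ar * bool) : 'I_l := if x.2 then qs x.1 else qt x.1.

Definition Rep := forall x : Ar * bool, 'M[k]_(d (dsrc x), d (dtgt x)).

Definition Marr (M : Rep) (a : Ar) : 'M[k]_(d (qs a), d (qt a)) := M (a, false).
Definition Mstar (M : Rep) (a : Ar) : 'M[k]_(d (qt a), d (qs a)) := M (a, true).

Definition rep_coord (c : {x : Ar * bool & ('I_(d (dsrc x)) * 'I_(d (dtgt x)))%type})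
  (M : Rep) : k := M (tag c) (tagged c).1 (tagged c).2.

(* M satisfies the generators of the ideal I (conform_mx only casts along   *)
(* the equalities of vertices guaranteed by the filtering conditions).       *)
Definition rep_rel (M : Rep) : Prop :=
  (forall a : Ar,
     Marr M a *m Mstar M a =
     \sum_(g : Ar | qt g == qs a)
        conform_mx (0 : 'M[k]_(d (qs a))) (Mstar M g *m Marr M g)) /\
  (forall a b : Ar, a != b -> qt a = qt b ->
     Marr M a *m conform_mx (0 : 'M[k]_(d (qt a), d (qs b))) (Mstar M b) = 0).

Definition rep_delta (M : Rep) : Prop :=
  forall a : Ar,
    row_free (Marr M a) /\
    ((Marr M a :&:
       \sum_(b : Ar | (b != a) && (qt b == qt a))
          conform_mx (0 : 'M[k]_(d (qt a))) <<Marr M b>>)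
      <= (0 : 'M[k]_(d (qt a))))%MS.

Definition RepDelta (M : Rep) : Prop := rep_rel M /\ rep_delta M.

Definition GLorb (M N : Rep) : Prop :=
  exists g : forall i : 'I_l, 'M[k]_(d i),
    (forall i, g i \in unitmx) /\
    (forall x, N x = invmx (g (dsrc x)) *m M x *m g (dtgt x)).

End QuiverRep.

(* V = 'rV[k]_n (row vectors); gl(V) = 'M_n acting by v |-> v *m x.          *)
(* The basis e_1, ..., e_n is given by the rows of an invertible matrix P    *)
(* (row i of P is e_(i+1)).  A type is a seq a = [:: a_0; ...; a_r] with     *)
(* 0 = a_0 < ... < a_r = n.  The flags are V_i = span(e_1..e_(a_i)) and      *)
(* V'_j = span(e_(n-b_j+1)..e_n): this is exactly a weakly opposite pair of  *)
(* types a, b together with a fixed basis as in the definition.              *)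
Definition is_type (n : nat) (a : seq nat) : bool :=
  [&& sorted ltn a, head 1%N a == 0%N & last 0%N a == n].

Lemma edge_lt1 (l : nat) (e : 'I_l.-1) : (e < l)%N.
Proof. exact: leq_trans (ltn_ord e) (leq_pred l). Qed.

Lemma edge_lt2 (l : nat) (e : 'I_l.-1) : (e.+1 < l)%N.
Proof. by case: l e => [|l] [e He]. Qed.

Section Seaweed.
Variables (k : fieldType) (n : nat) (P : 'M[k]_n) (a b : seq nat).

Definition span_rows (lo hi : nat) : 'M[k]_n :=
  \matrix_(i < n, j < n) (if (lo <= i < hi)%N then P i j else 0).

Definition Vsp (i : nat) := span_rows 0 (nth 0%N a i).
Definition Vsp' (j : nat) := span_rows (n - nth 0%N b j) n.

Definition seaweed (x : 'M[k]_n) : Prop :=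
  (forall i, (i < size a)%N -> (Vsp i *m x <= Vsp i)%MS) /\
  (forall j, (j < size b)%N -> (Vsp' j *m x <= Vsp' j)%MS).

Definition seaweed_grp (g : 'M[k]_n) : Prop :=
  g \in unitmx /\
  (forall i, (i < size a)%N -> (Vsp i *m g == Vsp i)%MS) /\
  (forall j, (j < size b)%N -> (Vsp' j *m g == Vsp' j)%MS).

Definition mseq : seq nat := sort leq (undup (a ++ [seq (n - x)%N | x <- b])).
Definition lnum : nat := (size mseq).-1.
Definition mm (s : nat) : nat := nth 0%N mseq s.

Definition Esp (s : nat) := span_rows (mm s.-1) (mm s).

(* nilpotent radical: x in q whose diagonal blocks w.r.t. V = E_1 + ... + E_l *)
(* vanish; P *m x *m invmx P is the matrix of x in the basis e.              *)
Definition nilrad (x : 'M[k]_n) : Prop :=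
  seaweed x /\
  forall s : nat, (1 <= s <= lnum)%N -> forall i j : 'I_n,
    (mm s.-1 <= i < mm s)%N -> (mm s.-1 <= j < mm s)%N ->
    (P *m x *m invmx P) i j = 0.

Definition Qorb (x y : 'M[k]_n) : Prop :=
  exists2 g, seaweed_grp g & y = invmx g *m x *m g.

Definition mat_coord (ij : 'I_n * 'I_n) (x : 'M[k]_n) : k := x ij.1 ij.2.

Definition uu (s : nat) : nat := find (fun i => (Esp s <= Vsp i)%MS) (iota 0 (size a)).
Definition ll (s : nat) : nat := find (fun j => (Esp s <= Vsp' j)%MS) (iota 0 (size b)).

Definition Ysp (s : nat) : 'M[k]_n := (Vsp (uu s) :&: Vsp' (ll s))%MS.

(* vertex i : 'I_lnum corresponds to s = i+1; dimension vector *)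
Definition dvec (i : 'I_lnum) : nat := \rank (Ysp i.+1).

(* edge e : 'I_lnum.-1 between vertices e, e+1 (i.e. s = e+1, s+1 = e+2) *)
Definition fwd (e : nat) : bool := (Ysp e.+1 < Ysp e.+2)%MS.
Definition bwd (e : nat) : bool := (Ysp e.+2 < Ysp e.+1)%MS.

Definition Arr : finType := {e : 'I_lnum.-1 | fwd e || bwd e}.

Definition vleft (e : 'I_lnum.-1) : 'I_lnum := Ordinal (edge_lt1 e).
Definition vright (e : 'I_lnum.-1) : 'I_lnum := Ordinal (edge_lt2 e).

Definition asrc (x : Arr) : 'I_lnum :=
  if fwd (val x) then vleft (val x) else vright (val x).
Definition atgt (x : Arr) : 'I_lnum :=
  if fwd (val x) then vright (val x) else vleft (val x).

Definition SRep := @Rep k lnum Arr asrc atgt dvec.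
Definition SRepDelta : SRep -> Prop := @RepDelta k lnum Arr asrc atgt dvec.
Definition SGLorb : SRep -> SRep -> Prop := @GLorb k lnum Arr asrc atgt dvec.
Definition Srep_coord := @rep_coord k lnum Arr asrc atgt dvec.

End Seaweed.

(* Main.v *)
Require Import Defs.
From HB Require Import structures.
From mathcomp Require Import all_boot all_order all_algebra zify.
From mathcomp Require boolp.
Set Implicit Arguments. Unset Strict Implicit. Unset Printing Implicit Defensive.
Import GRing.Theory.
Local Open Scope ring_scope.

(* At every vertex t, Y_t is the direct sum of E_t and of the Y_s with s -> t.
   An element x of n maps Y_t into the sum of these Y_s, and it yields the
   representation with spaces Y_t whose arrows are the inclusions Y_s -> Y_t and
   whose starred arrows are the components Y_t -> Y_s of x.  Conversely, in a
   Delta-filtered representation the maps M_a are jointly injective at each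
   vertex, so along the (acyclic) quiver they can be moved to the standard
   inclusions; the endomorphisms theta_t, the sum of the M_a M_a^* with t(a) = t,
   commute with these inclusions by the relations and glue to an element of n.
   The same gluing identifies the stabilizer of the standard inclusions in GL(d)
   with the seaweed group.  Hence n is a linear cross-section of Rep_Delta.  An
   open orbit in Rep_Delta restricts to one in n; the other way, the move to
   standard inclusions is given, on principal open sets covering Rep_Delta, by
   rational functions whose denominators are determinants. *)

Lemma orbit_inj (X : Type) (S : X -> Prop) (R : X -> X -> Prop) (O1 O2 : orbits S R) :
  sval O1 = sval O2 -> O1 = O2.
Proof. by case: O1 O2 => [U1 H1] [U2 H2] /=; apply: boolp.eq_exist. Qed.

(** * Transfer of orbits along a cross-section *)

Section OrbitTransfer.
Variables (X X' : Type) (S : X -> Prop) (R : X -> X -> Prop).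
Variables (S' : X' -> Prop) (R' : X' -> X' -> Prop) (F : X -> X').
Hypothesis R'refl : forall y, R' y y.
Hypothesis R'sym : forall y z, R' y z -> R' z y.
Hypothesis R'trans : forall x y z, R' x y -> R' y z -> R' x z.
Hypothesis S_closed : forall x y, S x -> R x y -> S y.
Hypothesis S'_closed : forall x y, S' x -> R' x y -> S' y.
Hypothesis F_sub : forall x, S x -> S' (F x).
Hypothesis F_orb : forall x y, S x -> S y -> (R x y <-> R' (F x) (F y)).
Hypothesis F_meets : forall y, S' y -> exists2 x, S x & R' (F x) y.

Lemma orbit_push_subproof (O : orbits S R) :
  exists2 y, S' y & (fun z => exists2 x, sval O x & R' (F x) z) = R' y.
Proof.
case: O => O [x Sx /= EO] /=; rewrite EO; exists (F x); first exact: F_sub.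
apply: boolp.funext => z; apply: boolp.propext; split=> [[w xw wz]|xz].
  have Sw := S_closed Sx xw.
  by apply: R'trans wz; apply/(F_orb Sx Sw).
by exists x => //; apply/(F_orb Sx Sx).
Qed.

Lemma orbit_pull_subproof (O : orbits S' R') :
  exists2 x, S x & (fun z => S z /\ sval O (F z)) = R x.
Proof.
case: O => O [y S'y /= EO] /=; rewrite EO; have [x Sx xy] := F_meets S'y; exists x => //.
apply: boolp.funext => z; apply: boolp.propext; split=> [[Sz yz]|xz].
  by apply/(F_orb Sx Sz); apply: R'trans yz.
have Sz := S_closed Sx xz; split=> //.
by apply: (R'trans (R'sym xy)); apply/(F_orb Sx Sz).
Qed.

Definition orbit_push (O : orbits S R) : orbits S' R' :=
  exist (fun U => exists2 y, S' y & U = R' y) _ (orbit_push_subproof O).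

Definition orbit_pull (O : orbits S' R') : orbits S R :=
  exist (fun U => exists2 x, S x & U = R x) _ (orbit_pull_subproof O).

(** [F_orb] makes the map on orbits injective and [F_meets] makes it surjective; the inverse takes
    the preimage of an orbit in [S]. *)
Lemma orbits_bijection : exists f : orbits S R -> orbits S' R', bijective f.
Proof.
exists orbit_push; exists orbit_pull.
- move=> O; have [x Sx EU] := svalP O.
  apply: orbit_inj; apply: boolp.funext => z; apply: boolp.propext; rewrite /= EU; split.
    case=> Sz [w xw wz]; have Sw := S_closed Sx xw.
    by apply/(F_orb Sx Sz); apply: R'trans wz; apply/(F_orb Sx Sw).
  move=> xz; have Sz := S_closed Sx xz; split=> //.
  by exists z.
- move=> O; have [y S'y EU] := svalP O.
  apply: orbit_inj; apply: boolp.funext => z; apply: boolp.propext; rewrite /= EU; split.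
    by case=> w [Sw yw] wz; apply: R'trans wz.
  move=> yz; have S'z := S'_closed S'y yz.
  have [x Sx xz] := F_meets S'z; exists x => //; split=> //.
  exact: R'trans (R'sym xz).
Qed.

(** * Open orbits under polynomial maps and rational charts *)

Variables (k : fieldType) (I I' : Type) (coord : I -> X -> k)
  (coord' : I' -> X' -> k).

Hypothesis F_poly : forall i, polyfun coord (fun x => coord' i (F x)).

Lemma polyfun_pullback f : polyfun coord' f -> polyfun coord (fun x => f (F x)).
Proof.
elim=> [c|i|p q _ Hp _ Hq|p q _ Hp _ Hq] //; first exact: pf_const.
- exact: pf_add.
- exact: pf_mul.
Qed.

(** Preimages of open sets under a polynomial map are open, and by [F_orb] the preimage of an orbit
    meets [S] in a single orbit. *)
Lemma open_orbit_pullback : has_open_orbit S' R' coord' -> has_open_orbit S R coord.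
Proof.
case=> y S'y [_ [W [Fam [Fam_poly WE]] yW]].
have [x Sx xy] := F_meets S'y; exists x => //; split; first by move=> z; apply: S_closed.
exists (fun z => W (F z)).
  exists (fun g => exists2 f, Fam f & g = fun z => f (F z)); split.
    by move=> _ [f Ff ->]; apply: polyfun_pullback; apply: Fam_poly.
  move=> z; split=> [/WE[f Ff fz]|[_ [f Ff ->] fz]]; last by apply/WE; exists f.
  by exists (fun z => f (F z)) => //; exists f.
move=> z Sz; rewrite (F_orb Sx Sz) -(yW _ (F_sub Sz)).
by split; apply: R'trans => //; apply: R'sym.
Qed.

(* Charts: on the nonvanishing locus of D c, the map chart c retracts S' onto
   the cross-section F S along orbits, and D c clears its denominators. *)
Variables (C : Type) (D : C -> X' -> k) (chart : C -> X' -> X).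
Hypothesis D_poly : forall c, polyfun coord' (D c).
Hypothesis chart_poly : forall c i, exists2 p, polyfun coord' p &
  forall y, D c y != 0 -> p y = D c y * coord i (chart c y).
Hypothesis chart_cover : forall y, S' y -> exists c, D c y != 0.
Hypothesis chart_S : forall c y, S' y -> D c y != 0 -> S (chart c y).
Hypothesis chart_R : forall c y, S' y -> D c y != 0 -> R' (F (chart c y)) y.

Lemma polyfun_exp f m : polyfun coord' f -> polyfun coord' (fun y => f y ^+ m).
Proof.
move=> pf; elim: m => [|m IH].
  by rewrite (_ : (fun _ => _) = fun=> 1); [exact: pf_const|apply: boolp.funext].
rewrite (_ : (fun _ => _) = fun y => f y * f y ^+ m); first exact: pf_mul.
by apply: boolp.funext => y; rewrite exprS.
Qed.

(** The coordinates of the chart have denominator [D c], so a power of [D c] clears denominators in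
    any polynomial in them; sums and products add the exponents. *)
Lemma polyfun_chart c f : polyfun coord f -> exists m, exists2 p, polyfun coord' p &
  forall y, D c y != 0 -> p y = D c y ^+ m * f (chart c y).
Proof.
have E m := polyfun_exp m (D_poly c).
elim=> [x|i|f1 f2 _ [m1 [p1 P1 E1]] _ [m2 [p2 P2 E2]]
  |f1 f2 _ [m1 [p1 P1 E1]] _ [m2 [p2 P2 E2]]].
- exists 0%N; exists (fun=> x); first exact: pf_const.
  by move=> y _; rewrite mul1r.
- by have [p pp Ep] := chart_poly c i; exists 1%N; exists p.
- exists (m1 + m2)%N; exists (fun y => D c y ^+ m2 * p1 y + D c y ^+ m1 * p2 y).
    by apply: pf_add; apply: pf_mul.
  by move=> y Dy; rewrite E1 // E2 // exprD mulrDr !mulrA [D c y ^+ m2 * _]mulrC.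
- exists (m1 + m2)%N; exists (fun y => p1 y * p2 y); first exact: pf_mul.
  by move=> y Dy; rewrite E1 // E2 // exprD mulrACA.
Qed.

Lemma open_orbit_charts : has_open_orbit S R coord -> has_open_orbit S' R' coord'.
Proof.
case=> x Sx [_ [W [Fam [Fam_poly WE]] xW]].
have xO z (Sz : S z) : R' (F x) (F z) <-> W z by rewrite -(F_orb Sx Sz); apply: xW.
exists (F x); first exact: F_sub.
split; first by move=> y; apply: S'_closed; apply: F_sub.
exists (fun y => exists c, D c y != 0 /\ W (chart c y)).
  (* The largest possible family: all polynomial functions whose nonvanishing locus lies in the set.
     Openness then asks only for one such function at each point. *)
  exists (fun h => polyfun coord' h /\ forall y, h y != 0 ->
    exists c, D c y != 0 /\ W (chart c y)).
  split=> [h []//|y]; split=> [[c [Dy /WE[f Ff fy]]]|[h [_ hW] /hW//]].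
  have [m [p Pp Ep]] := polyfun_chart c (Fam_poly _ Ff).
  (* The extra factor [D c] confines the nonvanishing locus to the domain of the chart, where [p] is
     known to be related to [f]. *)
  exists (fun z => D c z * p z); last first.
    by rewrite Ep // !mulf_neq0 // expf_neq0.
  split=> [|z]; first exact: pf_mul.
  rewrite mulf_eq0 negb_or => /andP[Dz]; rewrite Ep // mulf_eq0 negb_or.
  by case/andP=> _ fz; exists c; split=> //; apply/WE; exists f.
move=> y S'y; split=> [xy|[c [Dy]]].
  have [c Dy] := chart_cover S'y; exists c; split=> //; apply/xO.
    exact: chart_S.
  by apply: (R'trans xy); apply: R'sym; apply: chart_R.
move/xO => /(_ (chart_S S'y Dy)) H; apply: (R'trans H); exact: chart_R.
Qed.

End OrbitTransfer.

Lemma invmxM (R : comUnitRingType) (n : nat) (A B : 'M[R]_n) :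
  A \in unitmx -> B \in unitmx -> invmx (A *m B) = invmx B *m invmx A.
Proof.
move=> uA uB; have uAB : A *m B \in unitmx by rewrite unitmx_mul uA.
apply: (can_inj (mulKmx uAB)).
by rewrite mulmxV // mulmxA -(mulmxA A) mulmxV // mulmx1 mulmxV.
Qed.

(** * The action of GL(d) on representations *)

Section GLAction.
Variables (k : fieldType) (l : nat) (Ar : finType) (qs qt : Ar -> 'I_l)
          (d : 'I_l -> nat).
Local Notation Rep := (@Rep k l Ar qs qt d).
Local Notation GLorb := (@GLorb k l Ar qs qt d).
Implicit Types M N : Rep.

Lemma GLorb_refl M : GLorb M M.
Proof.
exists (fun i => 1%:M); split=> [i|x]; first exact: unitmx1.
by rewrite invmx1 mul1mx mulmx1.
Qed.

Lemma GLorb_sym M N : GLorb M N -> GLorb N M.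
Proof.
case=> g [gU NE]; exists (fun i => invmx (g i)); split=> [i|x].
  by rewrite unitmx_inv.
by rewrite NE invmxK !mulmxA mulmxV // mul1mx -mulmxA mulmxV // mulmx1.
Qed.

Lemma GLorb_trans M N L : GLorb M N -> GLorb N L -> GLorb M L.
Proof.
case=> g [gU NE] [h [hU LE]]; exists (fun i => g i *m h i); split=> [i|x].
  by rewrite unitmx_mul gU hU.
by rewrite LE NE invmxM // !mulmxA.
Qed.

Lemma conform_conj (g : forall i, 'M[k]_(d i)) (i j : 'I_l) (A : 'M[k]_(d i)) : i = j ->
  conform_mx (0 : 'M_(d j)) (invmx (g i) *m A *m g i) =
  invmx (g j) *m conform_mx 0 A *m g j.
Proof. by move=> e; case: j / e; rewrite !conform_mx_id. Qed.

(** The relations are conjugated by [g]. For the independence condition, the intersection formed in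
    [N] is carried back into the one of [M] by the inverse of [g (qt a)]. *)
Lemma RepDelta_closed M N : RepDelta M -> GLorb M N -> RepDelta N.
Proof.
case=> -[rel1 rel2] del [g [gU NE]].
have NA a : Marr N a = invmx (g (qs a)) *m Marr M a *m g (qt a) by exact: (NE (a, false)).
have NS a : Mstar N a = invmx (g (qt a)) *m Mstar M a *m g (qs a) by exact: (NE (a, true)).
split; [split|].
- move=> a; rewrite NA NS !mulmxA mulmxK //.
  transitivity (invmx (g (qs a)) *m (Marr M a *m Mstar M a) *m g (qs a)).
    by rewrite !mulmxA.
  rewrite rel1 mulmx_sumr mulmx_suml; apply: eq_bigr => c /eqP e.
  by rewrite -conform_conj // NA NS !mulmxA mulmxK.
- move=> a b nab e; rewrite NA NS.
  have -> : conform_mx (0 : 'M[k]_(d (qt a), d (qs b)))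
     (invmx (g (qt b)) *m Mstar M b *m g (qs b)) =
     invmx (g (qt a)) *m conform_mx 0 (Mstar M b) *m g (qs b).
    by move: (Mstar M b); rewrite -e => B; rewrite !conform_mx_id.
  by rewrite !mulmxA mulmxK // -(mulmxA (invmx _)) rel2 // mulmx0 mul0mx.
- move=> a; have [rf dj] := del a; rewrite NA; split.
    by rewrite /row_free mxrankMfree ?row_free_unit // -mxrank_tr trmx_mul
      mxrankMfree ?mxrank_tr // row_free_unit unitmx_tr unitmx_inv.
  set A := Marr M a in rf dj *; set B := (\sum_(_ | _) _)%MS in dj *.
  set W := (_ :&: _)%MS.
  have WA : (W *m invmx (g (qt a)) <= A)%MS.
    have /submxP[D ->] : (W <= invmx (g (qs a)) *m A *m g (qt a))%MS by apply: capmxSl.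
    by rewrite -!mulmxA mulmxV // mulmx1 mulmxA submxMl.
  have WB : (W *m invmx (g (qt a)) <= B)%MS.
    have WS : (W <= B *m g (qt a))%MS.
      apply: submx_trans (capmxSr _ _) _; apply/sumsmx_subP => b /andP[nb /eqP e].
      rewrite NA; apply: (@submx_trans _ _ _ _ _ _
        (conform_mx (0 : 'M[k]_(d (qt a))) <<Marr M b>>%MS *m g (qt a))); last first.
        apply: submxMr; apply: (sumsmx_sup b) => //; by rewrite nb e eqxx.
      move: (Marr M b); rewrite -e => A'; rewrite !conform_mx_id genmxE.
      apply: (@submx_trans _ _ _ _ _ _ (A' *m g (qt b))); last by rewrite submxMr ?genmxE.
      by rewrite -mulmxA submxMl.
    by move/(submxMr (invmx (g (qt a)))): WS; rewrite -mulmxA mulmxV // mulmx1.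
  have : (W *m invmx (g (qt a)) <= (0 : 'M[k]_(d (qt a))))%MS.
    by apply: submx_trans dj; rewrite sub_capmx WA WB.
  rewrite !submx0 => /eqP W0; apply/eqP.
  by rewrite -[W](mulmxKV (gU (qt a))) W0 mul0mx.
Qed.

End GLAction.

(** * Polynomial matrix-valued functions *)

Section PolyMatrix.
Variables (k : fieldType) (X I : Type) (coord : I -> X -> k).
Local Notation polyfun := (polyfun coord).

Lemma polyfun_ext f g : f =1 g -> polyfun f -> polyfun g.
Proof. by move/boolp.funext->. Qed.

Lemma polyfun_sum (T : Type) (r : seq T) (Q : pred T) (f : T -> X -> k) :
  (forall i, Q i -> polyfun (f i)) -> polyfun (fun x => \sum_(i <- r | Q i) f i x).
Proof.
move=> pf; elim: r => [|i r IH].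
  by apply: (polyfun_ext (f := fun=> 0)) => [x|]; rewrite ?big_nil //; apply: pf_const.
case Qi: (Q i).
  apply: (polyfun_ext (f := fun x => f i x + \sum_(j <- r | Q j) f j x)) => [x|].
    by rewrite big_cons Qi.
  by apply: pf_add => //; apply: pf.
by apply: polyfun_ext IH => x; rewrite big_cons Qi.
Qed.

Lemma polyfun_prod (T : Type) (r : seq T) (Q : pred T) (f : T -> X -> k) :
  (forall i, Q i -> polyfun (f i)) -> polyfun (fun x => \prod_(i <- r | Q i) f i x).
Proof.
move=> pf; elim: r => [|i r IH].
  by apply: (polyfun_ext (f := fun=> 1)) => [x|]; rewrite ?big_nil //; apply: pf_const.
case Qi: (Q i).
  apply: (polyfun_ext (f := fun x => f i x * \prod_(j <- r | Q j) f j x)) => [x|].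
    by rewrite big_cons Qi.
  by apply: pf_mul => //; apply: pf.
by apply: polyfun_ext IH => x; rewrite big_cons Qi.
Qed.

Definition polymx p q (F : X -> 'M[k]_(p, q)) :=
  forall i j, polyfun (fun x => F x i j).

Lemma polymx_ext p q (F G : X -> 'M[k]_(p, q)) : F =1 G -> polymx F -> polymx G.
Proof. by move/boolp.funext->. Qed.

Lemma polymx_const p q (A : 'M[k]_(p, q)) : polymx (fun=> A).
Proof. by move=> i j; apply: pf_const. Qed.

Lemma polymx_add p q (F G : X -> 'M[k]_(p, q)) :
  polymx F -> polymx G -> polymx (fun x => F x + G x).
Proof.
move=> pF pG i j; apply: (polyfun_ext (f := fun x => F x i j + G x i j)).
  by move=> x; rewrite mxE.
exact: pf_add.
Qed.

Lemma polymx_mul p q r (F : X -> 'M[k]_(p, q)) (G : X -> 'M[k]_(q, r)) :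
  polymx F -> polymx G -> polymx (fun x => F x *m G x).
Proof.
move=> pF pG i j; apply: (polyfun_ext (f := fun x => \sum_h F x i h * G x h j)).
  by move=> x; rewrite mxE.
by apply: polyfun_sum => h _; apply: pf_mul.
Qed.

Lemma polymx_scale p q f (F : X -> 'M[k]_(p, q)) :
  polyfun f -> polymx F -> polymx (fun x => f x *: F x).
Proof.
move=> pf pF i j; apply: (polyfun_ext (f := fun x => f x * F x i j)).
  by move=> x; rewrite mxE.
exact: pf_mul.
Qed.

Lemma polymx_sum p q (T : Type) (r : seq T) (Q : pred T) (F : T -> X -> 'M[k]_(p, q)) :
  (forall i, Q i -> polymx (F i)) -> polymx (fun x => \sum_(i <- r | Q i) F i x).
Proof.
move=> pF i j; apply: (polyfun_ext (f := fun x => \sum_(h <- r | Q h) F h x i j)).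
  by move=> x; rewrite summxE.
by apply: polyfun_sum => h Qh; apply: pF.
Qed.

Lemma polyfun_det p (F : X -> 'M[k]_p) : polymx F -> polyfun (fun x => \det (F x)).
Proof.
move=> pF; apply: polyfun_sum => s _; apply: pf_mul; first exact: pf_const.
by apply: polyfun_prod => i _; apply: pF.
Qed.

Lemma polymx_adj p (F : X -> 'M[k]_p) : polymx F -> polymx (fun x => \adj (F x)).
Proof.
move=> pF i j; apply: (polyfun_ext (f := fun x =>
  (-1) ^+ (j + i) * \det (row' j (col' i (F x))))).
  by move=> x; rewrite mxE.
apply: pf_mul; first exact: pf_const.
apply: polyfun_det => a b.
by apply: polyfun_ext (pF (lift j a) (lift i b)) => x; rewrite !mxE.
Qed.

End PolyMatrix.

(** * Representations from endomorphisms of a glued space *)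

(* J s embeds Y_s in V = k^n, K s retracts V onto Y_s, eps s is the projection
   onto E_s; the decomposition Y_t = E_t + (sum of the Y_s, s -> t) is direct. *)
Section Gluing.
Variables (k : fieldType) (l n : nat) (Ar : finType) (qs qt : Ar -> 'I_l)
          (d : 'I_l -> nat).
Variables (J : forall s, 'M[k]_(d s, n)) (K : forall s, 'M[k]_(n, d s))
          (eps : 'I_l -> 'M[k]_n).
Local Notation Rep := (@Rep k l Ar qs qt d).
Local Notation GLorb := (@GLorb k l Ar qs qt d).
Local Notation RepDelta := (@RepDelta k l Ar qs qt d).
Local Notation pi s := (K s *m J s).
Local Notation inc a := (J (qs a) *m K (qt a)).

Hypothesis JK : forall s, J s *m K s = 1%:M.
Hypothesis eps_sum : \sum_s eps s = 1%:M.
Hypothesis eps_idem : forall s, eps s *m eps s = eps s.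
Hypothesis eps_orth : forall s t, s != t -> eps s *m eps t = 0.
Hypothesis pi_dec : forall t, pi t = eps t + \sum_(c | qt c == t) pi (qs c).
Hypothesis JK_orth : forall a b, a != b -> qt a = qt b -> J (qs a) *m K (qs b) = 0.
Hypothesis epsK : forall a, eps (qt a) *m K (qs a) = 0.
Hypothesis Jeps : forall a, J (qs a) *m eps (qt a) = 0.
Hypothesis d_lt : forall a, (d (qs a) < d (qt a))%N.

(** [pi t - eps t] projects onto the sum of the Y_s with s -> t, so [x] has to send E_t into that
    sum. *)
Definition nil_end (x : 'M[k]_n) :=
  forall t, eps t *m x = eps t *m x *m (pi t - eps t).

Definition stab (g : 'M[k]_n) := forall t, J t *m g = J t *m g *m pi t.

Definition glue (h : forall t, 'M[k]_(d t)) : 'M[k]_n :=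
  \sum_t eps t *m K t *m h t *m J t.

Definition end_rep (x : 'M[k]_n) : Rep :=
  fun ab => J (dsrc qs qt ab) *m (if ab.2 then x else 1%:M) *m K (dtgt qs qt ab).

Lemma Marr_end_rep x a : Marr (end_rep x) a = inc a.
Proof. by rewrite /Marr /end_rep /= mulmx1. Qed.

Lemma Mstar_end_rep x a : Mstar (end_rep x) a = J (qt a) *m x *m K (qs a).
Proof. by []. Qed.

Lemma Jpi t : J t *m pi t = J t.
Proof. by rewrite mulmxA JK mul1mx. Qed.

(** On Y_(qs a), the decomposition of [pi (qt a)] loses E_(qt a) and every summand except that of
    [a]; hence Y_(qs a) lies in Y_(qt a). *)
Lemma Jpi_arr a : J (qs a) *m pi (qt a) = J (qs a).
Proof.
rewrite pi_dec mulmxDr Jeps add0r mulmx_sumr (bigD1 a) //= Jpi big1 ?addr0 //.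
by move=> b /andP[/eqP e nb]; rewrite mulmxA JK_orth ?mul0mx // eq_sym.
Qed.

Lemma eps_pi t : eps t *m pi t = eps t.
Proof.
rewrite pi_dec mulmxDr eps_idem mulmx_sumr big1 ?addr0 // => a /eqP <-.
by rewrite mulmxA epsK mul0mx.
Qed.

(** The Y_t span V, since each contains E_t and the E_t add up to V. *)
Lemma J_ext m (A B : 'M[k]_(n, m)) : (forall t, J t *m A = J t *m B) -> A = B.
Proof.
move=> E; rewrite -[A]mul1mx -[B]mul1mx -eps_sum !mulmx_suml.
by apply: eq_bigr => t _; rewrite -eps_pi -!mulmxA E.
Qed.

Lemma J_dec m t (A : 'M[k]_(n, m)) : J t *m A = J t *m eps t *m A +
  \sum_(c | qt c == t) J t *m K (qs c) *m (J (qs c) *m A).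
Proof.
rewrite -{1}(Jpi t) pi_dec mulmxDr mulmxDl mulmx_sumr mulmx_suml.
by congr (_ + _); apply: eq_bigr => c _; rewrite !mulmxA.
Qed.

Lemma pi_sub_eps t : pi t - eps t = \sum_(c | qt c == t) pi (qs c).
Proof. by rewrite pi_dec addrC addKr. Qed.

Lemma J_arr_sub a : J (qs a) *m (pi (qt a) - eps (qt a)) = J (qs a).
Proof. by rewrite mulmxBr Jpi_arr Jeps subr0. Qed.

(** Dimensions strictly increase along arrows, so the quiver has no oriented cycle and [d] serves as
    induction measure. *)
Lemma d_ind (T : 'I_l -> Prop) :
  (forall t, (forall c, qt c = t -> T (qs c)) -> T t) -> forall t, T t.
Proof.
move=> H t; move: {2}(d t).+1 (ltnSn (d t)) => m; elim: m t => // m IH t tm.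
by apply: H => c e; apply: IH; rewrite -e in tm; apply: leq_trans (d_lt c) _.
Qed.

Lemma eps_glue h s : eps s *m glue h = eps s *m K s *m h s *m J s.
Proof.
rewrite /glue mulmx_sumr (bigD1 s) //= !mulmxA eps_idem big1 ?addr0 // => t ts.
by rewrite !mulmxA eps_orth ?mul0mx // eq_sym.
Qed.

(** Induction along the arrows: on the summand E_t of Y_t the glued map is [h t] by construction,
    and on a summand Y_s with s -> t it is [h s], which agrees with [h t] there by compatibility. *)
Lemma J_glue h : (forall a, h (qs a) *m inc a = inc a *m h (qt a)) ->
  forall t, J t *m glue h = h t *m J t.
Proof.
move=> hc; apply: d_ind => t IH.
rewrite J_dec -mulmxA eps_glue.
transitivity (J t *m (pi t) *m K t *m h t *m J t); last first.
  by rewrite Jpi JK mul1mx.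
rewrite {1}pi_dec mulmxDr !mulmxDl mulmx_sumr !mulmx_suml !mulmxA; congr (_ + _).
apply: eq_bigr => c /eqP e; rewrite -!mulmxA IH // -e; congr (_ *m (_ *m _)).
by rewrite -[X in h _ *m X]Jpi_arr 2!mulmxA -(mulmxA (h _)) hc !mulmxA.
Qed.

Lemma glue_unit h : (forall a, h (qs a) *m inc a = inc a *m h (qt a)) ->
  (forall t, h t \in unitmx) -> glue h \in unitmx.
Proof.
move=> hc hU; pose hi t := invmx (h t).
have hic a : hi (qs a) *m inc a = inc a *m hi (qt a).
  by apply: (can_inj (mulKmx (hU (qs a)))); rewrite mulmxA mulmxV // mul1mx
     mulmxA hc mulmxK.
have /mulmx1_unit[] // : glue h *m glue hi = 1%:M.
apply: J_ext => t; rewrite mulmxA J_glue // -mulmxA J_glue // mulmxA mulmxV //.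
by rewrite mul1mx mulmx1.
Qed.

(** On a summand Y_s of Y_t, induction puts the image in the sum of the Y_r with r -> s, hence in
    Y_s, which is itself one of the summands allowed at [t]. *)
Lemma nil_endJ x : nil_end x -> forall t, J t *m x = J t *m x *m (pi t - eps t).
Proof.
move=> nx; apply: d_ind => t IH; rewrite J_dec mulmxDl mulmx_suml.
congr (_ + _); first by rewrite -[LHS]mulmxA nx !mulmxA.
apply: eq_bigr => c /eqP e.
rewrite -!mulmxA; congr (_ *m (_ *m _)).
rewrite mulmxA (IH _ e) -!mulmxA -e; congr (_ *m (_ *m _)).
rewrite mulmxBl -mulmxA J_arr_sub; congr (_ - _).
by rewrite -{2}eps_pi -!mulmxA J_arr_sub eps_pi.
Qed.

Lemma nil_endJ_sum x : nil_end x ->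
  forall t, J t *m x = \sum_(c | qt c == t) J t *m x *m K (qs c) *m J (qs c).
Proof.
move=> nx t; rewrite {1}(nil_endJ nx) pi_sub_eps mulmx_sumr.
by apply: eq_bigr => c _; rewrite mulmxA.
Qed.

Lemma nil_end_stab x : nil_end x -> stab x.
Proof.
move=> nx t; rewrite {2}(nil_endJ nx) -mulmxA mulmxBl eps_pi mulmxA -[_ *m K t]mulmxA JK mulmx1.
exact: nil_endJ.
Qed.

(** [g] carries Y_t into itself injectively, so its compression to Y_t has full rank. *)
Lemma stab_unit g : g \in unitmx -> stab g ->
  forall t, J t *m g *m K t \in unitmx.
Proof.
move=> gU gs t; rewrite -row_free_unit /row_free eqn_leq rank_leq_row /=.
have rJ : (d t <= \rank (J t *m g))%N.
  rewrite mxrankMfree ?row_free_unit //.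
  by rewrite -{1}(mxrank1 k (d t)) -(JK t) mxrankM_maxl.
by apply: leq_trans rJ _; rewrite {1}gs mulmxA mxrankM_maxl.
Qed.

Lemma stabJ g t : stab g -> J t *m g = J t *m g *m K t *m J t.
Proof. by move=> gs; rewrite {1}gs mulmxA. Qed.

Lemma stab_arr g a : stab g ->
  (J (qs a) *m g *m K (qs a)) *m inc a = inc a *m (J (qt a) *m g *m K (qt a)).
Proof.
move=> gs; rewrite mulmxA -stabJ // !mulmxA; congr (_ *m _ *m _).
by rewrite -mulmxA Jpi_arr.
Qed.

Lemma stab_conj_nil_end x g : nil_end x -> g \in unitmx -> stab g ->
  nil_end (invmx g *m x *m g).
Proof.
move=> nx gU gs t; rewrite -{1 2}eps_pi -!mulmxA; congr (_ *m (_ *m _)).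
have Ji : J t *m invmx g = invmx (J t *m g *m K t) *m J t.
  by apply: (can_inj (mulKmx (stab_unit gU gs t))); rewrite !mulmxA mulmxV
    ?stab_unit // mul1mx -stabJ // mulmxK.
rewrite !mulmxA Ji -!mulmxA; congr (_ *m _); rewrite !mulmxA nil_endJ_sum //.
rewrite !mulmx_suml; apply: eq_bigr => c /eqP e; rewrite -!mulmxA.
congr (_ *m (_ *m (_ *m _))); rewrite mulmxA stabJ // -!mulmxA -e.
by rewrite J_arr_sub.
Qed.

Lemma stab_end_rep x g : nil_end x -> g \in unitmx -> stab g ->
  GLorb (end_rep x) (end_rep (invmx g *m x *m g)).
Proof.
move=> nx gU gs; have hU := stab_unit gU gs.
exists (fun t => J t *m g *m K t); split=> // -[a []];
  apply: (can_inj (mulKmx (hU _))); rewrite !mulmxA mulmxV // mul1mx;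
  rewrite /end_rep /dsrc /dtgt /=.
  rewrite -(stabJ _ gs) mulmxK // {1}nil_endJ_sum //.
  rewrite !mulmx_suml (bigD1 a) //= big1 ?addr0 //.
  move=> b /andP[/eqP e nb]; rewrite -[_ *m g]mulmxA (stabJ _ gs) -!mulmxA.
  by rewrite JK_orth // !mulmx0.
by rewrite !mulmx1 -mulmxA stab_arr // !mulmxA.
Qed.

(** Both representations have the standard inclusions as arrows, so a base change between them
    commutes with these and glues to some [g]; the starred arrows then say that [g] conjugates [x]
    to [y]. *)
Lemma end_rep_stab x y : nil_end x -> nil_end y -> GLorb (end_rep x) (end_rep y) ->
  exists2 g, g \in unitmx /\ stab g & y = invmx g *m x *m g.
Proof.
move=> nx ny [h [hU E]].
have hc a : h (qs a) *m inc a = inc a *m h (qt a).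
  have := E (a, false); rewrite /end_rep /= !mulmx1 => {1}->.
  by rewrite /dsrc /dtgt /= !mulmxA mulmxV // mul1mx.
have hs a : h (qt a) *m (J (qt a) *m y *m K (qs a)) = J (qt a) *m x *m K (qs a) *m h (qs a).
  by have := E (a, true); rewrite /end_rep /dsrc /dtgt /= => ->; rewrite !mulmxA mulmxV // mul1mx.
have gU := glue_unit hc hU.
exists (glue h).
  by split=> // t; rewrite J_glue // -mulmxA Jpi.
apply: (can_inj (mulKmx gU)); rewrite !mulmxA mulmxV // mul1mx.
apply: J_ext => t; rewrite !mulmxA J_glue // -mulmxA [J t *m y]nil_endJ_sum // mulmx_sumr.
rewrite [in RHS]nil_endJ_sum // mulmx_suml; apply: eq_bigr => c /eqP <-.
by rewrite -[RHS]mulmxA J_glue // !mulmxA -hs !mulmxA.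
Qed.

(** First relation: on Y_(qs a) the endomorphism [x] is the sum of its components along the sources
    of arrows into [qs a]. Second: [x] preserves Y_(qs a), which has no component along another
    source with the same target. *)
Lemma end_rep_Delta x : nil_end x -> RepDelta (end_rep x).
Proof.
move=> nx; split; [split|].
- move=> a; rewrite Marr_end_rep Mstar_end_rep.
  transitivity (J (qs a) *m x *m K (qs a)).
    by rewrite !mulmxA -(mulmxA _ (K _)) Jpi_arr.
  rewrite {1}nil_endJ_sum // mulmx_suml; apply: eq_bigr => c /eqP e.
  rewrite Marr_end_rep Mstar_end_rep -e conform_mx_id.
  by rewrite !mulmxA.
- move=> a b nab e; rewrite Marr_end_rep Mstar_end_rep e.
  rewrite conform_mx_id -e !mulmxA -(mulmxA _ (K _)) Jpi_arr.
  by rewrite (nil_end_stab nx) !mulmxA -(mulmxA _ (J _)) JK_orth // mulmx0.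
(* [Z] retracts Y_(qt a) onto Y_(qs a): it splits the inclusion of [a] and kills the other sources,
   so the intersection vanishes. *)
- move=> a; pose Z := J (qt a) *m K (qs a).
  have aZ : Marr (end_rep x) a *m Z = 1%:M.
    by rewrite Marr_end_rep mulmxA -(mulmxA (J _)) Jpi_arr JK.
  split.
    apply/row_freeP; by exists Z.
  set W := (_ :&: _)%MS.
  have /submxP[D WE] : (W <= Marr (end_rep x) a)%MS by apply: capmxSl.
  have : (W <= kermx Z)%MS.
    apply: submx_trans (capmxSr _ _) _; apply/sumsmx_subP => b /andP[nb /eqP e].
    apply/sub_kermxP.
    have cJ : (conform_mx (0 : 'M[k]_(d (qt a))) <<Marr (end_rep x) b>> <= J (qs b) *m K (qt a))%MS.
      by rewrite Marr_end_rep -e conform_mx_id genmxE.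
    have Jb : J (qs b) *m pi (qt a) = J (qs b) by rewrite -e Jpi_arr.
    have /submxP[B ->] := cJ; rewrite /Z -!mulmxA (mulmxA (K _)) (mulmxA (J (qs b))).
    by rewrite Jb JK_orth // mulmx0.
  move/sub_kermxP; rewrite WE -mulmxA aZ mulmx1 => ->.
  by rewrite mul0mx sub0mx.
Qed.

(** * Framings of Delta-filtered representations *)

Definition theta (M : Rep) t : 'M[k]_(d t) :=
  \sum_(c | qt c == t) conform_mx 0 (Mstar M c *m Marr M c).

(** For invertible [G t] this is a base change between the maps [Marr M a] and the standard
    inclusions. Invertibility is kept apart because the polynomial formula for a framing can
    degenerate. *)
Definition framing (M : Rep) (G : forall t, 'M[k]_(d t)) :=
  forall a, G (qs a) *m Marr M a = inc a *m G (qt a).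

(** The second relation kills every term on the left except that of [a], and the first turns
    [Marr M a *m Mstar M a] into [theta M (qs a)]. *)
Lemma Marr_theta M a : rep_rel M ->
  Marr M a *m theta M (qt a) = theta M (qs a) *m Marr M a.
Proof.
case=> r1 r2; rewrite /theta mulmx_sumr (bigD1 a) //= conform_mx_id mulmxA r1.
rewrite [X in _ + X]big1 ?addr0 // => b /andP[/eqP e nb].
have ab : a != b by rewrite eq_sym.
move: (r2 a b ab (esym e)).
move: (Mstar M b) (Marr M b); rewrite e => B A; rewrite !conform_mx_id mulmxA => ->.
by rewrite mul0mx.
Qed.

Definition framed_end (M : Rep) (G : forall t, 'M[k]_(d t)) t : 'M[k]_(d t) :=
  G t *m theta M t *m invmx (G t).

Section Framed.
Variables (M : Rep) (G : forall t, 'M[k]_(d t)).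
Hypotheses (Mrel : rep_rel M) (GU : forall t, G t \in unitmx) (MG : framing M G).

Local Notation h := (framed_end M G).

Lemma framed_arr a : Marr M a *m invmx (G (qt a)) = invmx (G (qs a)) *m inc a.
Proof.
by apply: (can_inj (mulKmx (GU (qs a)))); rewrite mulmxA MG mulmxK // mulmxA
  mulmxV // mul1mx.
Qed.

Lemma framed_theta a : h (qs a) *m inc a = inc a *m h (qt a).
Proof.
rewrite /framed_end -[LHS]mulmxA -framed_arr !mulmxA; congr (_ *m _).
by rewrite -(mulmxA (G _)) -Marr_theta // mulmxA MG.
Qed.

Lemma framed_theta_J t : h t *m J t = \sum_(c | qt c == t)
  G t *m conform_mx 0 (Mstar M c) *m invmx (G (qs c)) *m J (qs c).
Proof.
rewrite /framed_end /theta mulmx_sumr !mulmx_suml; apply: eq_bigr => c /eqP <-.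
rewrite !conform_mx_id -!mulmxA; congr (_ *m (_ *m _)).
by rewrite mulmxA framed_arr -!mulmxA Jpi_arr.
Qed.

Lemma framed_nil_end : nil_end (glue h).
Proof.
move=> t; rewrite eps_glue -[LHS]mulmxA -[X in _ = X *m _]mulmxA -[RHS]mulmxA.
congr (_ *m _); rewrite framed_theta_J mulmx_suml; apply: eq_bigr => c /eqP <-.
by rewrite -[RHS]mulmxA J_arr_sub.
Qed.

Lemma framed_orb : GLorb (end_rep (glue h)) M.
Proof.
exists G; split=> // -[a []]; apply: (can_inj (mulKmx (GU _)));
  rewrite !mulmxA mulmxV // mul1mx /end_rep /dsrc /dtgt /=; last first.
  by rewrite mulmx1; apply: MG.
rewrite J_glue; last exact: framed_theta.
rewrite framed_theta_J !mulmx_suml (bigD1 a) //= conform_mx_id big1 ?addr0.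
  by rewrite -!mulmxA (mulmxA (J _)) JK mul1mx mulVmx // mulmx1.
move=> b /andP[/eqP e nb].
by rewrite -(mulmxA _ (J _)) JK_orth // mulmx0 mul0mx.
Qed.

End Framed.

(** Isolating the term of [a] puts it in the intersection required to vanish, and [Marr M a] is row
    free. *)
Lemma delta_independent (M : Rep) a t m (v : forall b, 'M[k]_(m, d (qs b))) :
  rep_delta M -> qt a = t ->
  \sum_(b | qt b == t) v b *m conform_mx (0 : 'M_(d (qs b), d t)) (Marr M b) = 0 ->
  v a = 0.
Proof.
move=> /(_ a)[rf dj] <-; rewrite (bigD1 a) //= conform_mx_id => /eqP.
rewrite addr_eq0 => /eqP E.
suff : v a *m Marr M a = 0 by move=> va0; rewrite -[v a](mulmxKp rf) va0 mul0mx.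
apply/eqP; rewrite -submx0.
apply: submx_trans (_ : _ <= (0 : 'M[k]_(d (qt a))))%MS (sub0mx _ _).
apply: submx_trans dj.
rewrite sub_capmx submxMl /= E eqmx_opp summx_sub // => b /andP[e nb].
apply: (sumsmx_sup b); first by rewrite nb e.
apply: submx_trans (submxMl _ _) _.
by move: (Marr M b); rewrite (eqP e) => B; rewrite !conform_mx_id genmxE.
Qed.

(* Delta-filteredness says that the sum of the maps into a vertex is injective,
   so a framing extends over one more vertex by completing a basis. *)
Lemma framing_step (M : Rep) (G : forall t, 'M[k]_(d t)) t : rep_delta M ->
  (forall c, qt c = t -> G (qs c) \in unitmx) ->
  exists2 H : 'M[k]_(d t), H \in unitmx &
    forall c, qt c == t ->
      J (qs c) *m K t *m H = G (qs c) *m conform_mx 0 (Marr M c).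
Proof.
move=> Md GU.
(* In coordinates of Y_t, [p] projects onto the sum of the Y_(qs c) along E_t, and [A] is the map
   prescribed on that sum, extended by zero on E_t. *)
pose p := \sum_(c | qt c == t) J t *m pi (qs c) *m K t.
pose A := \sum_(c | qt c == t) J t *m K (qs c) *m G (qs c) *m
  conform_mx (0 : 'M_(d (qs c), d t)) (Marr M c).
have Jp c : qt c == t -> J (qs c) *m pi t = J (qs c) by move/eqP <-; exact: Jpi_arr.
have Js c : qt c == t -> J (qs c) *m (pi t - eps t) = J (qs c).
  by move/eqP <-; exact: J_arr_sub.
have cp c : qt c == t -> J (qs c) *m K t *m p = J (qs c) *m K t.
  move=> e; rewrite /p -mulmx_suml -mulmx_sumr -pi_sub_eps.
  by rewrite !mulmxA -(mulmxA _ (K t)) Jp // Js.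
have cA c : qt c == t -> J (qs c) *m K t *m A =
    G (qs c) *m conform_mx (0 : 'M_(d (qs c), d t)) (Marr M c).
  move=> e; rewrite /A mulmx_sumr (bigD1 c) //= big1 ?addr0.
    by rewrite !mulmxA -(mulmxA _ (K t)) Jp // JK mul1mx.
  move=> b /andP[/eqP eb nb]; rewrite !mulmxA -(mulmxA _ (K t)) Jp //.
  by rewrite JK_orth ?mul0mx // ?eb ?(eqP e) // eq_sym.
have pA : p *m A = A.
  rewrite {1}/p mulmx_suml; apply: eq_bigr => c e.
  by rewrite -!mulmxA (mulmxA (J (qs c))) cA.
(* Equal ranks mean that [A] is injective on the image of [p], so its restriction there extends to
   an invertible matrix. *)
have rk : \rank (p *m A) = \rank p.
  apply/eqP; rewrite eqn_leq mxrankM_maxl /= pA.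
  suff : (kermx A <= kermx p)%MS.
    move/mxrankS; rewrite !mxrank_ker leq_sub2lE ?rank_leq_row //.
  apply/sub_kermxP; rewrite /p mulmx_sumr big1 // => c e.
  have -> : kermx A *m (J t *m pi (qs c) *m K t) =
    (kermx A *m J t *m K (qs c)) *m (J (qs c) *m K t) by rewrite !mulmxA.
  have -> : kermx A *m J t *m K (qs c) = 0; last by rewrite mul0mx.
  have : kermx A *m A = 0 by apply: mulmx_ker.
  rewrite {2}/A mulmx_sumr => sum0.
  suff : kermx A *m J t *m K (qs c) *m G (qs c) = 0.
    by move/(congr1 (mulmx^~ (invmx (G (qs c))))); rewrite mulmxK ?mul0mx // GU // (eqP e).
  apply: (delta_independent (v := fun b => kermx A *m J t *m K (qs b) *m G (qs b)) Md (eqP e)).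
  by rewrite -[RHS]sum0; apply: eq_bigr => b _; rewrite !mulmxA.
have [H HU HE] := complete_unitmx rk.
exists H => // c e; rewrite -cA // -[in RHS]pA HE mulmxA cp //.
Qed.

Lemma framing_exists (M : Rep) : rep_delta M ->
  exists2 G : forall t, 'M[k]_(d t), forall t, G t \in unitmx & framing M G.
Proof.
move=> Md.
suff H m : exists2 G : forall t, 'M[k]_(d t),
    forall t, G t \in unitmx &
    forall a, (d (qt a) < m)%N -> G (qs a) *m Marr M a = inc a *m G (qt a).
  have [G GU GM] := H (\max_t d t).+1; exists G => // a; apply: GM.
  by rewrite ltnS leq_bigmax.
elim: m => [|m [G GU GM]]; first by exists (fun t => 1%:M) => // t; apply: unitmx1.
have /fin_all_exists[H HP] : forall t, exists H : 'M[k]_(d t), H \in unitmx /\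
    forall c, qt c == t ->
      J (qs c) *m K t *m H = G (qs c) *m conform_mx 0 (Marr M c).
  by move=> t; have [H] := framing_step (t := t) Md (fun c _ => GU (qs c)); exists H.
(* Values at vertices of dimension below [m] are kept, so arrows already treated stay compatible; an
   arrow into dimension exactly [m] starts at such a vertex and is served by [H]. *)
exists (fun t => if (d t < m)%N then G t else H t).
  by move=> t; case: ifP => _ //; case: (HP t).
move=> a; rewrite ltnS => am; rewrite (leq_trans (d_lt a) am).
case: ifP => [|_]; first exact: GM.
by have [_ /(_ a (eqxx _)) ->] := HP (qt a); rewrite conform_mx_id.
Qed.

(** * Polynomial charts *)

(* A framing is determined recursively along the arrows by its restrictions to
   the E_t, which a chart prescribes through C. Arrows increase d, so the
   recursion is stationary at t once m > d t. *)
Fixpoint frame_rec (C : forall t, 'M[k]_(d t)) (M : Rep) m t : 'M[k]_(d t) :=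
  if m is m'.+1 then
    J t *m eps t *m K t *m C t + \sum_(c | qt c == t) conform_mx 0
      (J (qt c) *m K (qs c) *m frame_rec C M m' (qs c) *m Marr M c)
  else 0.

Definition frame C M t := frame_rec C M (\max_s d s).+1 t.

Lemma frame_rec_stable C M m m' t : (d t < m)%N -> (d t < m')%N ->
  frame_rec C M m t = frame_rec C M m' t.
Proof.
elim: m m' t => // m IH [//|m'] t tm tm' /=; congr (_ + _).
apply: eq_bigr => c /eqP e; congr (conform_mx _ (_ *m _ *m _)).
by rewrite -e in tm tm'; apply: IH; apply: leq_trans (d_lt c) _.
Qed.

Lemma frameE C M t : frame C M t = J t *m eps t *m K t *m C t +
  \sum_(c | qt c == t) conform_mx 0
    (J (qt c) *m K (qs c) *m frame C M (qs c) *m Marr M c).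
Proof.
rewrite {1}/frame.
by rewrite (@frame_rec_stable C M _ (\max_s d s).+2) ?ltnS ?leqW ?leq_bigmax.
Qed.

(** Restricted to Y_(qs a), the term with [C] and those of the other arrows vanish, and the
    recursion returns the framing equation; the choice of [C] affects only invertibility. *)
Lemma frame_framing C M : framing M (frame C M).
Proof.
move=> a; rewrite [in RHS]frameE mulmxDr !mulmxA -(mulmxA (J (qs a)) (K _)) Jpi_arr Jeps !mul0mx add0r.
rewrite mulmx_sumr (bigD1 a) //= conform_mx_id big1 ?addr0.
  by rewrite !mulmxA -(mulmxA (J (qs a)) (K _)) Jpi_arr JK mul1mx.
move=> b /andP[/eqP e nb].
have Ja : J (qs a) *m pi (qt b) = J (qs a) by rewrite e Jpi_arr.
have ab : J (qs a) *m K (qs b) = 0 by rewrite JK_orth // eq_sym.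
case: (qt a) / e.
by rewrite conform_mx_id !mulmxA -(mulmxA (J (qs a)) (K _)) Ja ab !mul0mx.
Qed.

(** This is why the charts cover: an invertible framing of [M] indexes a chart whose domain contains
    [M]. *)
Lemma frame_fix G M t : framing M G -> frame G M t = G t.
Proof.
move=> GM; suff H m : forall t, (d t < m)%N -> frame_rec G M m t = G t.
  by apply: H; rewrite ltnS leq_bigmax.
elim: m => // m IH {}t tm /=.
rewrite -[RHS]mul1mx -(JK t) -[in RHS](Jpi t) pi_dec mulmxDr !mulmxDl; congr (_ + _).
rewrite mulmx_sumr !mulmx_suml; apply: eq_bigr => c /eqP e.
rewrite IH; last by rewrite -e in tm; apply: leq_trans (d_lt c) _.
by rewrite -mulmxA GM -e conform_mx_id !mulmxA.
Qed.

Definition chart_den C (M : Rep) := \prod_t \det (frame C M t).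
Definition chart C (M : Rep) : 'M[k]_n := glue (framed_end M (frame C M)).

Lemma chart_den_unit C M : chart_den C M != 0 -> forall t, frame C M t \in unitmx.
Proof.
by move=> D t; rewrite unitmxE unitfE; apply: contraNneq D => D; rewrite /chart_den (bigD1 t) //= D mul0r.
Qed.

Local Notation rcoord := (@rep_coord k l Ar qs qt d).

Lemma poly_rep ab : polymx rcoord (fun M : Rep => M ab).
Proof. by move=> i j; apply: (pf_coord rcoord (Tagged _ (i, j))). Qed.

Lemma poly_theta t : polymx rcoord (fun M : Rep => theta M t).
Proof.
apply: polymx_sum => c /eqP <-.
apply: (polymx_ext (F := fun M : Rep => Mstar M c *m Marr M c)).
  by move=> M; rewrite conform_mx_id.
by apply: polymx_mul; [exact: (@poly_rep (c, true))|exact: (@poly_rep (c, false))].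
Qed.

Lemma poly_frame C t : polymx rcoord (fun M => frame C M t).
Proof.
rewrite /frame; elim: _.+1 t => [|m IH] t /=; first exact: polymx_const.
apply: polymx_add; first exact: polymx_const.
apply: polymx_sum => c /eqP <-.
apply: (polymx_ext (F := fun M : Rep =>
  J (qt c) *m K (qs c) *m frame_rec C M m (qs c) *m Marr M c)).
  by move=> M; rewrite conform_mx_id.
apply: polymx_mul; last exact: (@poly_rep (c, false)).
by apply: polymx_mul (IH _); apply: polymx_const.
Qed.

Lemma poly_chart_den C : polyfun rcoord (chart_den C).
Proof. by apply: polyfun_prod => t _; apply: polyfun_det; apply: poly_frame. Qed.

Lemma poly_chart C ij : exists2 p, polyfun rcoord p &
  forall M, chart_den C M != 0 -> p M = chart_den C M * mat_coord ij (chart C M).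
Proof.
(* Each inverse is replaced by its adjugate, and the determinants at the other vertices complete the
   common denominator [chart_den]. *)
pose N (M : Rep) : 'M[k]_n := \sum_t (\prod_(s | s != t) \det (frame C M s)) *:
  (eps t *m K t *m (frame C M t *m theta M t *m \adj (frame C M t)) *m J t).
exists (fun M => N M ij.1 ij.2).
  have : polymx rcoord N; last by apply.
  apply: polymx_sum => t _; apply: polymx_scale.
    by apply: polyfun_prod => s _; apply: polyfun_det; apply: poly_frame.
  apply: polymx_mul; last exact: polymx_const.
  apply: polymx_mul; first exact: polymx_const.
  apply: polymx_mul; last by apply: polymx_adj; apply: poly_frame.
  by apply: polymx_mul; [apply: poly_frame|apply: poly_theta].
move=> M D; have -> : N M = chart_den C M *: chart C M; last by rewrite mxE.
rewrite /chart /glue scaler_sumr; apply: eq_bigr => t _.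
have uG := chart_den_unit D t; rewrite /framed_end /invmx uG -!scalemxAr -scalemxAl scalerA.
congr (_ *: _); rewrite /chart_den [in RHS](bigD1 t) //= mulrAC divff ?mul1r //.
by rewrite -unitfE -unitmxE.
Qed.

Theorem gluing_orbits (S : 'M[k]_n -> Prop) (R : 'M[k]_n -> 'M[k]_n -> Prop) :
  (forall x, S x <-> nil_end x) ->
  (forall x y, R x y <->
     exists2 g, g \in unitmx /\ stab g & y = invmx g *m x *m g) ->
  (exists f : orbits S R -> orbits RepDelta GLorb, bijective f) /\
  (has_open_orbit S R (@mat_coord k n) <-> has_open_orbit RepDelta GLorb rcoord).
Proof.
move=> SE RE.
have S_closed x y : S x -> R x y -> S y.
  by rewrite !SE RE => nx [g [gU gs] ->]; apply: stab_conj_nil_end.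
have F_sub x : S x -> RepDelta (end_rep x) by rewrite SE; apply: end_rep_Delta.
have F_orb x y : S x -> S y -> (R x y <-> GLorb (end_rep x) (end_rep y)).
  rewrite !SE RE => nx ny; split=> [[g [gU gs] ->]|]; first exact: stab_end_rep.
  exact: end_rep_stab.
have F_meets M : RepDelta M -> exists2 x, S x & GLorb (end_rep x) M.
  case=> Mr /framing_exists[G GU GM]; exists (glue (framed_end M G)).
    by apply/SE; apply: framed_nil_end.
  exact: framed_orb.
have R1 := @GLorb_refl k l Ar qs qt d; have R2 := @GLorb_sym k l Ar qs qt d.
have R3 := @GLorb_trans k l Ar qs qt d; have R4 := @RepDelta_closed k l Ar qs qt d.
split; first exact: orbits_bijection F_meets.
split.
  apply: (open_orbit_charts R2 R3 R4 F_sub F_orb (D := chart_den) (chart := chart)).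
  - exact: poly_chart_den.
  - exact: poly_chart.
  - move=> M [_ /framing_exists[G GU GM]]; exists G.
    apply/prodf_neq0 => t _; rewrite frame_fix // -unitfE -unitmxE; exact: GU.
  - move=> C M [Mr _] D; apply/SE; apply: framed_nil_end => //.
      exact: chart_den_unit.
    exact: frame_framing.
  - move=> C M [Mr _] D; apply: framed_orb => //; first exact: chart_den_unit.
    exact: frame_framing.
apply: (open_orbit_pullback R2 R3 S_closed F_sub F_orb F_meets).
case=> ab [i j]; rewrite /rep_coord /=.
have : polymx (@mat_coord k n) (fun x => end_rep x ab); last by apply.
apply: polymx_mul; last exact: polymx_const.
apply: polymx_mul; first exact: polymx_const.
case: ab.2; last exact: polymx_const.
by move=> u v; apply: (pf_coord (@mat_coord k n) (u, v)).
Qed.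

End Gluing.

(** * Coordinate projections *)

Section CoordinateProjections.
Variables (k : fieldType) (n : nat) (P : 'M[k]_n).
Hypothesis HP : P \in unitmx.
Implicit Types S T : pred nat.

Definition Dg (S : pred nat) : 'M[k]_n := \matrix_(i, j) ((i == j) && S i)%:R.
(** The projection of V onto the span of the basis vectors indexed by [S], along the remaining
    ones. *)
Definition Pr (S : pred nat) : 'M[k]_n := invmx P *m Dg S *m P.

Lemma Dg_mull S m (A : 'M[k]_(n, m)) i j : (Dg S *m A) i j = (S i)%:R * A i j.
Proof.
rewrite mxE (bigD1 i) //= big1 ?addr0 ?mxE ?eqxx // => h hi.
by rewrite mxE eq_sym (negPf hi) mul0r.
Qed.

Lemma Dg_mulr S m (A : 'M[k]_(m, n)) i j : (A *m Dg S) i j = A i j * (S j)%:R.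
Proof.
rewrite mxE (bigD1 j) //= big1 ?addr0 ?mxE ?eqxx // => h hi.
by rewrite mxE (negPf hi) mulr0.
Qed.

Lemma Pr_mul S T : Pr S *m Pr T = Pr [pred i | S i && T i].
Proof.
rewrite /Pr !mulmxA mulmxK //; congr (_ *m _); rewrite -mulmxA; congr (_ *m _).
apply/matrixP=> i j; rewrite Dg_mull !mxE -natrM mulnb /=.
by case: (i == j); rewrite ?andbF.
Qed.

Lemma eq_Pr S T : (forall i, (i < n)%N -> S i = T i) -> Pr S = Pr T.
Proof.
by move=> E; congr (_ *m _ *m _); apply/matrixP=> i j; rewrite !mxE E.
Qed.

Lemma Pr_idem S : Pr S *m Pr S = Pr S.
Proof. by rewrite Pr_mul; apply: eq_Pr => i _ /=; rewrite andbb. Qed.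

Lemma Pr_disjoint S T : (forall i, (i < n)%N -> S i -> ~~ T i) -> Pr S *m Pr T = 0.
Proof.
move=> E; rewrite Pr_mul /Pr.
have -> : Dg [pred i | S i && T i] = 0; last by rewrite mulmx0 mul0mx.
apply/matrixP=> i j; rewrite !mxE /=.
by case Si: (S i) => //=; rewrite ?(negPf (E i _ Si)) ?andbF.
Qed.

Lemma Pr_sum (T : finType) (Q : pred T) (S : T -> pred nat) (S0 : pred nat) :
  (forall i, (i < n)%N -> (S0 i)%:R = \sum_(c | Q c) (S c i)%:R :> k) ->
  Pr S0 = \sum_(c | Q c) Pr (S c).
Proof.
move=> E; rewrite /Pr -mulmx_suml -mulmx_sumr; congr (_ *m _ *m _).
apply/matrixP=> i j; rewrite summxE !mxE.
case: (altP (i =P j)) => [<-|ij] /=.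
  by rewrite E //; apply: eq_bigr => c _; rewrite !mxE eqxx.
by rewrite big1 // => c _; rewrite !mxE (negPf ij).
Qed.

Lemma Pr_add S0 S1 S2 : (forall i, (i < n)%N -> S0 i = (S1 i || S2 i) /\ ~~ (S1 i && S2 i)) ->
  Pr S0 = Pr S1 + Pr S2.
Proof.
move=> E; rewrite /Pr -mulmxDl -mulmxDr; congr (_ *m _ *m _).
apply/matrixP=> i j; rewrite !mxE; have [-> ] := E i (ltn_ord i).
by case: (i == j); case: (S1 i); case: (S2 i) => //=; rewrite ?addr0 ?add0r.
Qed.

Lemma span_Pr lo hi : (span_rows P lo hi :=: Pr [pred i | (lo <= i < hi)%N])%MS.
Proof.
have -> : span_rows P lo hi = Dg [pred i | (lo <= i < hi)%N] *m P.
  by apply/matrixP=> i j; rewrite Dg_mull !mxE /=; case: ifP => _; rewrite ?mul1r ?mul0r.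
by apply/eqmxP; rewrite /Pr -mulmxA submxMl andbT -{1}[X in (X <= _)%MS](mulKVmx HP) submxMl.
Qed.

Lemma sub_Pr S m (A : 'M[k]_(m, n)) : (A <= Pr S)%MS <-> A *m Pr S = A.
Proof.
split=> [/submxP[D ->]|<-]; last exact: submxMl.
by rewrite -mulmxA Pr_idem.
Qed.

(** In the basis [P] the two projections are diagonal 0/1 matrices selecting rows in [S] and columns
    in [T], so the equation amounts to one vanishing block. *)
Lemma block_Pr S T (x : 'M[k]_n) : Pr S *m x = Pr S *m x *m Pr T <->
  forall i j : 'I_n, S i -> ~~ T j -> (P *m x *m invmx P) i j = 0.
Proof.
set y := P *m x *m invmx P.
have -> : Pr S *m x = invmx P *m (Dg S *m y) *m P.
  by rewrite /Pr /y !mulmxA mulmxKV.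
have -> : invmx P *m (Dg S *m y) *m P *m Pr T = invmx P *m (Dg S *m y *m Dg T) *m P.
  by rewrite /Pr !mulmxA mulmxK.
split=> [E i j Si Tj|E].
  have {}E : Dg S *m y = Dg S *m y *m Dg T.
    apply: (can_inj (mulmxK HP)); apply: (can_inj (mulKmx (_ : invmx P \in unitmx))).
      by rewrite unitmx_inv.
    by rewrite !mulmxA in E *.
  move/matrixP/(_ i j): E; rewrite Dg_mulr !Dg_mull Si (negPf Tj) mul1r => ->.
  by rewrite mulr0.
congr (_ *m _ *m _); apply/matrixP=> i j; rewrite Dg_mulr !Dg_mull.
case Si: (S i); case Tj: (T j); rewrite ?mulr1 ?mul0r //.
by rewrite E ?Tj // mulr0 mul0r.
Qed.

Lemma Pr_sub S T : (Pr S <= Pr T)%MS <-> forall i, (i < n)%N -> S i -> T i.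
Proof.
rewrite sub_Pr Pr_mul; split=> [E i ni Si|E].
  move/(congr1 (fun A => P *m A *m invmx P)): E; rewrite /Pr !mulmxA mulmxV // !mul1mx.
  rewrite !mulmxK // => /matrixP/(_ (Ordinal ni) (Ordinal ni)).
  rewrite !mxE eqxx /= Si /=; case: (T i) => //= /esym E1.
  by case/eqP: (oner_neq0 k); exact: E1.
by apply: eq_Pr => i ni /=; case Si: (S i) => //=; apply: E.
Qed.

Lemma cap_Pr S T : (Pr S :&: Pr T :=: Pr [pred i | S i && T i])%MS.
Proof.
apply/eqmxP/andP; split; last first.
  rewrite sub_capmx; apply/andP; split; apply/Pr_sub => i _ /andP[] //.
apply/sub_Pr; rewrite -Pr_mul mulmxA.
have /sub_Pr -> : (Pr S :&: Pr T <= Pr S)%MS by apply: capmxSl.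
by have /sub_Pr -> : (Pr S :&: Pr T <= Pr T)%MS by apply: capmxSr.
Qed.

End CoordinateProjections.

(** * The blocks of a seaweed algebra *)

Section SeaweedBlocks.
Variables (k : fieldType) (n : nat) (P : 'M[k]_n) (a b : seq nat).
Hypotheses (HP : P \in unitmx) (Ha : is_type n a) (Hb : is_type n b).

Local Notation nb := [seq (n - x)%N | x <- b].
Local Notation mseq := (mseq n a b).
Local Notation lnum := (lnum n a b).
Local Notation mm := (mm n a b).
Local Notation Ysp := (Ysp P a b).
Local Notation Pr := (Pr P).

Lemma type_mem0 c : is_type n c -> 0%N \in c.
Proof. by case: c => //= x c /and3P[_ /eqP <- _]; rewrite mem_head. Qed.

Lemma type_memn c : is_type n c -> n \in c.
Proof. by case: c => // x c /and3P[_ _ /eqP <-] /=; apply: mem_last. Qed.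

Lemma type_nth_mono c i j : is_type n c -> (i <= j < size c)%N ->
  (nth 0 c i <= nth 0 c j)%N.
Proof.
move=> /and3P[sc _ _] /andP[ij jc].
have {}sc : sorted leq c by apply: sub_sorted sc => x y /ltnW.
by apply: (sorted_leq_nth leq_trans leqnn) => //; rewrite inE (leq_ltn_trans ij).
Qed.

Lemma type_le c x : is_type n c -> x \in c -> (x <= n)%N.
Proof.
move=> tc /(nthP 0%N)[i ic <-].
have := type_nth_mono (i := i) (j := (size c).-1) tc; rewrite nth_last.
case/and3P: tc => _ _ /eqP ->; apply.
by case: (size c) ic => // m; rewrite ltnS leqnn andbT.
Qed.

Lemma mem_mseq c : (c \in mseq) = (c \in a) || (c \in nb).
Proof. by rewrite mem_sort mem_undup mem_cat. Qed.

Lemma mem_nb c : c \in nb -> (c <= n)%N.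
Proof. by case/mapP=> x _ ->; apply: leq_subr. Qed.

Lemma mseq_le c : c \in mseq -> (c <= n)%N.
Proof. by rewrite mem_mseq => /orP[/type_le|/mem_nb]; auto. Qed.

Lemma mm_mono i j : (i < j < size mseq)%N -> (mm i < mm j)%N.
Proof.
case/andP=> ij jm; have sm : sorted ltn mseq.
  by rewrite ltn_sorted_uniq_leq sort_uniq undup_uniq sort_sorted //; apply: leq_total.
by apply: (sorted_ltn_nth ltn_trans) => //; rewrite inE (ltn_trans ij).
Qed.

Lemma mm_mem i : (i <= lnum)%N -> mm i \in mseq.
Proof.
move=> il; apply: mem_nth; have : 0%N \in mseq by rewrite mem_mseq type_mem0.
by rewrite /lnum in il; case: mseq il => //= x s _; rewrite ltnS.
Qed.

Lemma mm_size : size mseq = lnum.+1.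
Proof.
have : 0%N \in mseq by rewrite mem_mseq type_mem0.
by rewrite /lnum; case: mseq.
Qed.

Lemma mm_lt i j : (i < j <= lnum)%N -> (mm i < mm j)%N.
Proof. by move=> H; apply: mm_mono; rewrite mm_size ltnS. Qed.

Lemma mm_index c : c \in mseq -> exists2 i, (i <= lnum)%N & mm i = c.
Proof. by case/(nthP 0%N)=> i im <-; exists i => //; rewrite -ltnS -mm_size. Qed.

Lemma mm_next s c : (s < lnum)%N -> c \in mseq -> (mm s < c)%N -> (mm s.+1 <= c)%N.
Proof.
move=> sl /mm_index[j jl <-] sj; case: (leqP s.+1 j) => [|js].
  by rewrite leq_eqVlt => /predU1P[->//|sj']; apply/ltnW/mm_lt; rewrite sj'.
move: js; rewrite ltnS leq_eqVlt => /predU1P[E|js]; first by rewrite E ltnn in sj.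
by have := @mm_lt j s; lia.
Qed.

Lemma mm0 : mm 0 = 0%N.
Proof.
have [j jl E] : exists2 i, (i <= lnum)%N & mm i = 0%N.
  by apply: mm_index; rewrite mem_mseq type_mem0.
by case: j jl E => // j jl E; have := @mm_lt 0 j.+1; lia.
Qed.

Lemma mml : mm lnum = n.
Proof.
have [j jl E] : exists2 i, (i <= lnum)%N & mm i = n.
  by apply: mm_index; rewrite mem_mseq type_memn.
have := mseq_le (mm_mem (leqnn lnum)).
by have := @mm_lt j lnum; move: jl; rewrite leq_eqVlt => /predU1P[<-|jl]; lia.
Qed.

Lemma block_exists i : (i < n)%N -> exists t : 'I_lnum, (mm t <= i < mm t.+1)%N.
Proof.
move=> ni; have ex : exists s, (i < mm s)%N by exists lnum; rewrite mml.
case: (ex_minnP ex) => -[|s] si smin; first by rewrite mm0 in si.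
have sl : (s < lnum)%N.
  by rewrite ltnNge; apply/negP => ls; have := smin lnum; rewrite mml; lia.
exists (Ordinal sl) => /=; rewrite si andbT leqNgt; apply/negP => /smin; lia.
Qed.

Lemma block_bounds s : (0 < s <= lnum)%N -> (mm s.-1 < mm s <= n)%N.
Proof.
case/andP=> s0 sl; rewrite mm_lt ?prednK ?leqnn //=.
by apply: mseq_le; apply: mm_mem.
Qed.

Definition lA s : nat := nth 0%N a (uu P a b s).
(** [lB s] and [lA s] are the two ends of Y_s, seen as a half-open interval of zero-based basis
    indices. *)
Definition lB s : nat := (n - nth 0%N b (ll P a b s))%N.

Lemma sub_span (lo hi lo' hi' : nat) : (lo < hi <= n)%N ->
  (span_rows P lo hi <= span_rows P lo' hi')%MS = (lo' <= lo)%N && (hi <= hi')%N.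
Proof.
move=> lh; rewrite !span_Pr //; apply/idP/idP=> [/Pr_sub H|H].
  have H1 := H HP lo; have H2 := H HP hi.-1; rewrite /= in H1 H2.
  apply/andP; split; lia.
by apply/Pr_sub => // i ni /=; lia.
Qed.

(** The type contains n, so the search by [find] succeeds; as the type increases, the first index
    found gives the least value. *)
Lemma lA_prop s : (0 < s <= lnum)%N ->
  [/\ lA s \in a, (mm s <= lA s)%N & forall c, c \in a -> (mm s <= c)%N -> (lA s <= c)%N].
Proof.
move=> sl; have m1 := block_bounds sl.
have pE i : (Esp P a b s <= Vsp P a i)%MS = (mm s <= nth 0%N a i)%N.
  by rewrite /Esp /Vsp sub_span.
have hasp : has (fun i => (Esp P a b s <= Vsp P a i)%MS) (iota 0 (size a)).
  have /(nthP 0%N)[j ja E] := type_memn Ha.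
  apply/hasP; exists j; first by rewrite mem_iota.
  by rewrite pE E; lia.
have us : (uu P a b s < size a)%N by rewrite -[X in (_ < X)%N](size_iota 0) -has_find.
split; first exact: mem_nth.
  by have := nth_find 0%N hasp; rewrite nth_iota // add0n pE.
move=> c /(nthP 0%N)[j ja <-] sj; apply: type_nth_mono => //.
rewrite ja andbT leqNgt; apply/negP => ju.
by have := before_find 0%N ju; rewrite nth_iota // add0n pE sj.
Qed.

Lemma lB_prop s : (0 < s <= lnum)%N ->
  [/\ lB s \in nb, (lB s <= mm s.-1)%N &
      forall c, c \in nb -> (c <= mm s.-1)%N -> (c <= lB s)%N].
Proof.
move=> sl; have m1 := block_bounds sl.
have pE i : (Esp P a b s <= Vsp' P b i)%MS = (n - nth 0%N b i <= mm s.-1)%N.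
  by rewrite /Esp /Vsp' sub_span //; lia.
have hasp : has (fun i => (Esp P a b s <= Vsp' P b i)%MS) (iota 0 (size b)).
  have /(nthP 0%N)[j ja E] := type_memn Hb.
  apply/hasP; exists j; first by rewrite mem_iota.
  by rewrite pE E; lia.
have us : (ll P a b s < size b)%N by rewrite -[X in (_ < X)%N](size_iota 0) -has_find.
split; first by apply: map_f; apply: mem_nth.
  by have := nth_find 0%N hasp; rewrite nth_iota // add0n pE.
move=> c /mapP[x /(nthP 0%N)[j ja <-] ->] sj; apply: leq_sub2l; apply: type_nth_mono => //.
rewrite ja andbT leqNgt; apply/negP => ju.
by have := before_find 0%N ju; rewrite nth_iota // add0n pE sj.
Qed.

(** Vertices count from 0: [eb t] and [yb t] index the basis vectors of E_(t+1) and Y_(t+1). *)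
Definition eb (t : nat) : pred nat := [pred i | (mm t <= i < mm t.+1)%N].
Definition yb (t : nat) : pred nat := [pred i | (lB t.+1 <= i < lA t.+1)%N].

Lemma Ysp_Pr t : (Ysp t.+1 :=: Pr (yb t))%MS.
Proof.
apply: eqmx_trans (cap_eqmx (span_Pr HP _ _) (span_Pr HP _ _)) _.
apply: eqmx_trans (cap_Pr HP _ _) _.
rewrite (@eq_Pr _ _ P _ (yb t)); first exact: eqmx_refl.
move=> i ni; rewrite /yb /= ni andbT andbC; congr (_ && _).
Qed.

Lemma eb_yb t i : (t < lnum)%N -> eb t i -> yb t i.
Proof.
move=> tl; have [_ A1 _] := @lA_prop t.+1 tl; have [_ B1 _] := @lB_prop t.+1 tl.
by move: A1 B1; rewrite /eb /yb /=; lia.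
Qed.

(** * Cuts between neighbouring blocks and arrows of the quiver *)

Lemma lA_cut s : (0 < s <= lnum)%N -> mm s \in a -> lA s = mm s.
Proof. by move=> sl /[dup] sa; have [_ A1 A2] := lA_prop sl; move/A2 => /(_ (leqnn _)); lia. Qed.

Lemma lB_cut s : (s < lnum)%N -> mm s \in nb -> lB s.+1 = mm s.
Proof. by move=> sl /[dup] sa; have [_ A1 A2] := @lB_prop s.+1 sl; move/A2 => /(_ (leqnn _)) /=; rewrite /= in A1; lia. Qed.

Lemma lB_nocut s : (s.+1 < lnum)%N -> mm s.+1 \notin nb -> lB s.+2 = lB s.+1.
Proof.
move=> sl sn; have [B0 B1 B2] := @lB_prop s.+2 sl; have [C0 C1 C2] := @lB_prop s.+1 (ltnW sl).
rewrite /= in B1 B2 C1 C2.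
have := B2 _ C0; have := C2 _ B0; have ms : (mm s < mm s.+1)%N by apply: mm_lt; lia.
have : lB s.+2 != mm s.+1 by apply: contraNneq sn => <-.
have := @mm_next s (lB s.+2) (ltnW sl); rewrite mem_mseq B0 orbT => /(_ isT); lia.
Qed.

Lemma lA_nocut s : (s.+1 < lnum)%N -> mm s.+1 \notin a -> lA s.+2 = lA s.+1.
Proof.
move=> sl sn; have [B0 B1 B2] := @lA_prop s.+2 sl; have [C0 C1 C2] := @lA_prop s.+1 (ltnW sl).
have := B2 _ C0; have := C2 _ B0; have ms : (mm s.+1 < mm s.+2)%N by apply: mm_lt; lia.
have : lA s.+1 != mm s.+1 by apply: contraNneq sn => <-.
have := @mm_next s.+1 (lA s.+1) sl; rewrite mem_mseq C0 => /(_ isT); lia.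
Qed.

(** A cut outside [nb] comes from [a]: the left space stops at it, while the right one has the same
    left end and goes further. A cut in [nb] is where the right space starts, so it misses the index
    just before the cut. *)
Lemma fwdE e : (e.+1 < lnum)%N -> fwd P a b e = (mm e.+1 \notin nb).
Proof.
move=> el; have el' := ltnW el; rewrite /fwd ltmxE !Ysp_Pr.
have m1 := @block_bounds e.+1 el'; have m2 := @block_bounds e.+2 el.
have [A0 A1 _] := @lA_prop e.+1 el'; have [_ A2 _] := @lA_prop e.+2 el.
have [_ B1 _] := @lB_prop e.+1 el'; have [_ B2 _] := @lB_prop e.+2 el.
rewrite /= in m1 m2 B1 B2.
apply/idP/idP=> [/andP[/(Pr_sub HP) sub _]|sn].
  apply/negP=> /(lB_cut el) E; have := sub (mm e.+1).-1; rewrite /yb /=; lia.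
have := mm_mem el'; rewrite mem_mseq (negPf sn) orbF => /(lA_cut (s := e.+1) el') EA.
have EB := lB_nocut el sn; apply/andP; split.
  by apply/(Pr_sub HP) => i _; rewrite /yb /=; lia.
apply/negP=> /(Pr_sub HP)/(_ (mm e.+1)); rewrite /yb /=; lia.
Qed.

Lemma bwdE e : (e.+1 < lnum)%N -> bwd P a b e = (mm e.+1 \notin a).
Proof.
move=> el; have el' := ltnW el; rewrite /bwd ltmxE !Ysp_Pr.
have m1 := @block_bounds e.+1 el'; have m2 := @block_bounds e.+2 el.
have [A0 A1 _] := @lA_prop e.+1 el'; have [_ A2 _] := @lA_prop e.+2 el.
have [_ B1 _] := @lB_prop e.+1 el'; have [_ B2 _] := @lB_prop e.+2 el.
rewrite /= in m1 m2 B1 B2.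
apply/idP/idP=> [/andP[/(Pr_sub HP) sub _]|sn].
  apply/negP=> /(lA_cut (s := e.+1) el') E; have := sub (mm e.+1); rewrite /yb /=; lia.
have := mm_mem el'; rewrite mem_mseq (negPf sn) /= => /(lB_cut el) EB.
have EA := lA_nocut el sn; apply/andP; split.
  by apply/(Pr_sub HP) => i _; rewrite /yb /=; lia.
apply/negP=> /(Pr_sub HP)/(_ (mm e.+1).-1); rewrite /yb /=; lia.
Qed.

Lemma edge_lt (e : 'I_lnum.-1) : (e.+1 < lnum)%N.
Proof. exact: edge_lt2. Qed.

(** The source of an arrow into t is the part of Y_t left of E_t or the part right of it, according
    to the side from which the arrow comes. *)
Lemma arrow_block (x : Arr P a b) :
  ((val x).+1 = atgt x /\ yb (asrc x) =1 [pred i | lB (atgt x).+1 <= i < mm (atgt x)]%N) \/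
  (val x = atgt x :> nat /\
   yb (asrc x) =1 [pred i | mm (atgt x).+1 <= i < lA (atgt x).+1]%N).
Proof.
have el := edge_lt (val x); have el' := ltnW el; have := valP x.
rewrite /asrc /atgt; case: ifP => [fw _|fw /= bw].
  left; split=> //= i; rewrite fwdE // in fw; rewrite /yb /= lB_nocut //.
  by have := mm_mem el'; rewrite mem_mseq (negPf fw) orbF => /(lA_cut (s := (val x).+1) el') ->.
right; split=> //= i; rewrite bwdE // in bw; rewrite /yb /= lA_nocut //.
by have := mm_mem el'; rewrite mem_mseq (negPf bw) /= => /(lB_cut el) ->.
Qed.

Lemma arrow_yb (x : Arr P a b) i : yb (asrc x) i -> yb (atgt x) i && ~~ eb (atgt x) i.
Proof.
have tl := ltn_ord (atgt x); have m1 := @block_bounds (atgt x).+1 tl.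
have [_ A1 _] := @lA_prop (atgt x).+1 tl; have [_ B1 _] := @lB_prop (atgt x).+1 tl.
rewrite /= in B1 m1.
by case: (arrow_block x) => -[_ ->]; rewrite /yb /eb /=; lia.
Qed.

Lemma arrow_disjoint (x y : Arr P a b) i : atgt x = atgt y ->
  yb (asrc x) i -> yb (asrc y) i -> x = y.
Proof.
move=> E; have tl := ltn_ord (atgt x); have m1 := @block_bounds (atgt x).+1 tl.
rewrite /= in m1.
case: (arrow_block x) => -[vx ->]; case: (arrow_block y) => -[vy ->];
  rewrite -E /= in vy *; move=> h1 h2; try by exfalso; lia.
  by apply/val_inj/val_inj; apply: succn_inj; exact: etrans vx (esym vy).
by apply/val_inj/val_inj; exact: etrans vx (esym vy).
Qed.

Lemma arrow_exists (t : 'I_lnum) i : yb t i -> ~~ eb t i ->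
  exists2 x : Arr P a b, atgt x = t & yb (asrc x) i.
Proof.
move=> yi ei; have [il|il] := ltnP i (mm t).
  have t0 : (0 < t)%N by rewrite lt0n; apply: contraTneq il => ->; rewrite mm0.
  have tn : mm t \notin nb.
    by apply/negP=> /(lB_cut (ltn_ord t)) E; move: yi; rewrite /yb /=; lia.
  have el : (t.-1 < lnum.-1)%N by have := ltn_ord t; lia.
  have fw : fwd P a b (Ordinal el) by rewrite fwdE /= ?prednK.
  have ar : fwd P a b (Ordinal el) || bwd P a b (Ordinal el) by rewrite fw.
  pose x : Arr P a b := exist _ (Ordinal el) ar.
  have xt : atgt x = t by apply: val_inj; rewrite /atgt /= fw /= prednK.
  exists x => //; case: (arrow_block x) => -[/= vx ->]; rewrite xt in vx *.
    by move: yi; rewrite /yb /=; lia.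
  by lia.
have ih : (mm t.+1 <= i)%N by move: ei; rewrite /eb /= il /= -leqNgt.
have tn : mm t.+1 \notin a.
  by apply/negP=> /(lA_cut (s := t.+1) (ltn_ord t)) E; move: yi; rewrite /yb /=; lia.
have tl : (t.+1 < lnum)%N.
  rewrite ltn_neqAle ltn_ord andbT; apply: contraNneq tn => ->.
  by rewrite mml type_memn.
have el : (t < lnum.-1)%N by lia.
have bw : bwd P a b (Ordinal el) by rewrite bwdE.
(* [atgt] tests [fwd] first, so the forward case has to be excluded: a cut outside [a] belongs to
   [nb]. *)
have fw : fwd P a b (Ordinal el) = false.
  rewrite fwdE //=; apply/negbTE; rewrite negbK.
  by have := mm_mem (ltn_ord t); rewrite mem_mseq (negPf tn).
have ar : fwd P a b (Ordinal el) || bwd P a b (Ordinal el) by rewrite bw orbT.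
pose x : Arr P a b := exist _ (Ordinal el) ar.
have xt : atgt x = t by apply: val_inj; rewrite /atgt /= fw.
exists x => //; case: (arrow_block x) => -[/= vx ->]; rewrite xt in vx *.
  by lia.
by move: yi; rewrite /yb /=; lia.
Qed.

(** * Inclusions, retractions and the block form of q, n and Q *)

Definition Jm (s : 'I_lnum) : 'M[k]_(dvec P s, n) := row_base (Ysp s.+1).
(** The pseudo-inverse alone need not kill the basis vectors outside Y_s; the leading [Pr (yb s)]
    does, so that [Km s *m Jm s] is the coordinate projection. *)
Definition Km (s : 'I_lnum) : 'M[k]_(n, dvec P s) := Pr (yb s) *m pinvmx (Jm s).

Lemma Jm_Pr s : Jm s *m Pr (yb s) = Jm s.
Proof. by apply/sub_Pr => //; rewrite eq_row_base Ysp_Pr. Qed.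

Lemma JmKm s : Jm s *m Km s = 1%:M.
Proof. by rewrite mulmxA Jm_Pr mulmxVp // row_base_free. Qed.

Lemma KmJm s : Km s *m Jm s = Pr (yb s).
Proof. by rewrite mulmxKpV // eq_row_base Ysp_Pr. Qed.

Lemma eb_disjoint (s t : 'I_lnum) i : s != t -> eb s i -> ~~ eb t i.
Proof.
move=> st; rewrite /eb /=; wlog lt : s t st / (s < t)%N => [H|].
  have := st; rewrite neq_ltn => /orP[|lt]; first exact: H.
  by move=> e1; apply/negP=> e2; have := H t s; rewrite eq_sym e2 e1 => /(_ st lt isT).
have : (mm s.+1 <= mm t)%N; last by lia.
have := ltn_ord t; move: lt; rewrite leq_eqVlt => /predU1P[->//|lt] tl.
by apply/ltnW/mm_lt; rewrite lt ltnW.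
Qed.

Lemma Pr_eb_sum : \sum_(s < lnum) Pr (eb s) = 1%:M.
Proof.
rewrite -(@Pr_sum _ _ P _ predT (fun s : 'I_lnum => eb s) predT).
  have -> : 1%:M = invmx P *m 1%:M *m P by rewrite mulmx1 mulVmx.
  by congr (_ *m _ *m _); apply/matrixP=> i j; rewrite !mxE andbT.
move=> i /block_exists[t ti]; rewrite (bigD1 t) //= [eb t i]ti big1 ?addr0 // => s st.
by rewrite (negPf (eb_disjoint _ ti)) // eq_sym.
Qed.

Definition zb (t : nat) : pred nat := [pred i | yb t i && ~~ eb t i].

Lemma Pr_zb (t : 'I_lnum) : Pr (yb t) = Pr (eb t) + Pr (zb t).
Proof.
apply: Pr_add => i _; have := @eb_yb t i (ltn_ord t).
rewrite /zb inE; by case: (eb t i) => [->|_] //=; rewrite andbT.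
Qed.

Lemma Pr_zb_sum (t : 'I_lnum) :
  Pr (zb t) = \sum_(c : Arr P a b | atgt c == t) Pr (yb (asrc c)).
Proof.
apply: Pr_sum => i _; case zi : (zb t i); last first.
  rewrite big1 // => c /eqP ct; case ci : (yb (asrc c) i) => //.
  by have := arrow_yb ci; rewrite ct => zc; rewrite /zb /= zc in zi.
case/andP: zi => yi ei; have [x xt xi] := arrow_exists yi ei.
rewrite (bigD1 x) ?xt ?eqxx //= xi big1 ?addr0 // => c /andP[/eqP ct cx].
case ci : (yb (asrc c) i) => //; case/eqP: cx.
by apply: arrow_disjoint ci xi; rewrite ct xt.
Qed.

(** Y_t is the intersection of the smallest members of the two flags containing E_t. Conversely each
    flag member is a sum of blocks E_t, and by minimality it contains the corresponding Y_t. *)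
Lemma seaweed_blockP x : seaweed P a b x <->
  forall (t : 'I_lnum) (i j : 'I_n), eb t i -> ~~ yb t j -> (P *m x *m invmx P) i j = 0.
Proof.
have stabE lo hi : (span_rows P lo hi *m x <= span_rows P lo hi)%MS <->
    forall i j : 'I_n, (lo <= i < hi)%N -> ~~ (lo <= j < hi)%N ->
      (P *m x *m invmx P) i j = 0.
  rewrite -(block_Pr HP [pred i | lo <= i < hi]%N [pred i | lo <= i < hi]%N).
  rewrite (eqmxMr x (span_Pr HP lo hi)) span_Pr //.
  by rewrite sub_Pr //; split=> /esym.
split=> [[Sa Sb] t i j ti yj|H].
  have [A0 A1 _] := @lA_prop t.+1 (ltn_ord t); have [B0 B1 _] := @lB_prop t.+1 (ltn_ord t).
  rewrite /eb /yb /= in ti yj B1.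
  have [jA|jA] := leqP (lA t.+1) j.
    case/(nthP 0%N): A0 => c ca E; have /stabE -> // := Sa c ca; rewrite E; lia.
  case/mapP: B0 => y /(nthP 0%N)[c cb <-] E; have /stabE -> // := Sb c cb; have := ltn_ord i; rewrite -E; lia.
split=> c cs; apply/stabE => i j iS jS; have [t ti] := block_exists (ltn_ord i);
  apply: (H t) => //; rewrite /yb /=.
  have [_ _ A2] := @lA_prop t.+1 (ltn_ord t).
  have := mem_nth 0%N cs; move: (nth 0%N a c) iS jS => v iS jS cm.
  have := A2 _ cm; have := @mm_next t v (ltn_ord t).
  by rewrite mem_mseq cm => /(_ isT); lia.
have [_ _ B2] := @lB_prop t.+1 (ltn_ord t).
have : (n - nth 0 b c)%N \in nb by apply: map_f; apply: mem_nth.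
move: (n - nth 0%N b c)%N iS jS => v iS jS cm; have := B2 _ cm.
have := @mm_next t v (ltn_ord t); rewrite mem_mseq cm orbT => /(_ isT).
have := ltn_ord j; rewrite /=; lia.
Qed.

(** The vanishing diagonal block removes E_t from the target Y_t allowed by the seaweed condition,
    which leaves [zb t]. *)
Lemma nilrad_nil_end x : nilrad P a b x <-> nil_end Jm Km (fun s => Pr (eb s)) x.
Proof.
have zE (t : 'I_lnum) : Km t *m Jm t - Pr (eb t) = Pr (zb t).
  by rewrite KmJm Pr_zb addrC addKr.
have nE : nil_end Jm Km (fun s => Pr (eb s)) x <->
  forall (t : 'I_lnum) (i j : 'I_n), eb t i -> ~~ zb t j -> (P *m x *m invmx P) i j = 0.
  by split=> H t; have := H t; rewrite zE block_Pr.
rewrite nE; split=> [[/seaweed_blockP Sx Dx] t i j ti|H].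
  rewrite /zb /= negb_and negbK => /orP[|tj]; first exact: Sx.
  by apply: (Dx t.+1) => //; rewrite ltn_ord.
split; first by apply/seaweed_blockP => t i j ti yj; apply: (H t) => //; rewrite /zb /= negb_and yj.
move=> [//|s] sl i j si sj; apply: (H (Ordinal sl)) => //.
by rewrite /zb /= negb_and negbK; apply/orP; right.
Qed.

(** For invertible [g], stability of a flag member is equality by rank. The block form on the E_s
    extends to the Y_t, and restricting from Y_t to E_t gives the converse. *)
Lemma seaweed_grp_stab g : seaweed_grp P a b g <-> g \in unitmx /\ stab Jm Km g.
Proof.
have sE : stab Jm Km g <-> forall (t : 'I_lnum) (i j : 'I_n),
    yb t i -> ~~ yb t j -> (P *m g *m invmx P) i j = 0.
  have tE (t : 'I_lnum) : Jm t *m g = Jm t *m g *m (Km t *m Jm t) <->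
      Pr (yb t) *m g = Pr (yb t) *m g *m Pr (yb t).
    rewrite KmJm; split=> E.
      have -> : Pr (yb t) *m g = Km t *m (Jm t *m g) by rewrite mulmxA KmJm.
      by rewrite -mulmxA -E.
    have -> : Jm t *m g = Jm t *m (Pr (yb t) *m g) by rewrite mulmxA Jm_Pr.
    by rewrite -mulmxA -E.
  by split=> H t; have := H t; rewrite tE block_Pr.
have gE : seaweed_grp P a b g <-> g \in unitmx /\ seaweed P a b g.
  have eqg m (A : 'M[k]_(m, n)) : g \in unitmx -> (A *m g <= A)%MS -> (A *m g == A)%MS.
    move=> gU sA; rewrite -(geq_leqif (mxrank_leqif_eq sA)).
    by rewrite mxrankMfree // row_free_unit.
  split=> [[gU [H1 H2]]|[gU [H1 H2]]]; split=> //; split=> c cs.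
  - by have /andP[] := H1 c cs.
  - by have /andP[] := H2 c cs.
  - by apply: eqg => //; apply: H1.
  - by apply: eqg => //; apply: H2.
rewrite gE; split=> -[gU]; rewrite ?sE => H; split=> //.
  (* An index of Y_t lies in some block E_s; the ends of Y_t are cuts, so E_s lies in Y_t, and
     minimality puts Y_s in Y_t. *)
  move=> t i j ti tj; have [s si] := block_exists (ltn_ord i).
  move/seaweed_blockP: H => /(_ s i j si); apply.
  have [A0 _ _] := @lA_prop t.+1 (ltn_ord t); have [B0 _ _] := @lB_prop t.+1 (ltn_ord t).
  have [_ _ /(_ _ A0) A2] := @lA_prop s.+1 (ltn_ord s).
  have [_ _ /(_ _ B0) B2] := @lB_prop s.+1 (ltn_ord s).
  have := @mm_next s (lA t.+1) (ltn_ord s); rewrite mem_mseq A0 => /(_ isT).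
  have := @mm_next s (lB t.+1) (ltn_ord s); rewrite mem_mseq B0 orbT => /(_ isT).
  by move: ti tj; rewrite /yb /= in B2 *; lia.
apply/seaweed_blockP => t i j ti; apply: H.
by apply: eb_yb.
Qed.

Theorem seaweed_orbits :
  (exists f : orbits (@nilrad k n P a b) (@Qorb k n P a b) ->
              orbits (@SRepDelta k n P a b) (@SGLorb k n P a b),
     bijective f) /\
  (has_open_orbit (@nilrad k n P a b) (@Qorb k n P a b) (@mat_coord k n)
   <->
   has_open_orbit (@SRepDelta k n P a b) (@SGLorb k n P a b)
                  (@Srep_coord k n P a b)).
Proof.
have disj (x : Arr P a b) i : (i < n)%N -> yb (asrc x) i -> ~~ eb (atgt x) i.
  by move=> _ /arrow_yb/andP[].
apply: (@gluing_orbits k lnum n (Arr P a b) (@asrc k n P a b) (@atgt k n P a b)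
  (@dvec k n P a b) Jm Km (fun s => Pr (eb s))).
- exact: JmKm.
- exact: Pr_eb_sum.
- by move=> s; apply: Pr_idem.
- by move=> s t st; apply: Pr_disjoint => // i _; apply: eb_disjoint.
- by move=> t; rewrite KmJm Pr_zb Pr_zb_sum; congr (_ + _); apply: eq_bigr => c _; rewrite KmJm.
- move=> x y xy E; rewrite -Jm_Pr mulmxA -[X in X *m _]mulmxA Pr_disjoint ?mulmx0 ?mul0mx //.
  by move=> i _ xi; apply: contraNN xy => yi; apply/eqP; apply: arrow_disjoint xi yi.
- move=> x; rewrite mulmxA Pr_disjoint ?mul0mx // => i ni ei.
  by apply/negP=> /(disj _ _ ni); rewrite ei.
- by move=> x; rewrite -Jm_Pr -mulmxA Pr_disjoint ?mulmx0 // => i; apply: disj.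
- move=> x; have := valP x; rewrite /asrc /atgt.
  by case: ifP => [fw _|_ /= bw]; apply: rank_ltmx.
- exact: nilrad_nil_end.
- move=> x y; split=> [[g /seaweed_grp_stab gs ->]|[g gs ->]]; exists g => //.
  exact/seaweed_grp_stab.
Qed.

End SeaweedBlocks.

Theorem mainTheorem4 (k : closedFieldType) (char0 : [pchar k] =i pred0)
    (n : nat) (P : 'M[k]_n) (a b : seq nat)
    (HP : P \in unitmx) (Ha : is_type n a) (Hb : is_type n b) :
  (exists f : orbits (@nilrad k n P a b) (@Qorb k n P a b) ->
              orbits (@SRepDelta k n P a b) (@SGLorb k n P a b),
     bijective f) /\
  (has_open_orbit (@nilrad k n P a b) (@Qorb k n P a b) (@mat_coord k n)
   <->
   has_open_orbit (@SRepDelta k n P a b) (@SGLorb k n P a b)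
                  (@Srep_coord k n P a b)).
Proof. exact: seaweed_orbits. Qed.
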